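(* Let $t_m>0$ be the minimum intercept time of the Minimum-Time Intercept Problem (MTIP). If the final point $E(t_m)$ of the MTIP lies in the interior of $\mathcal{R}_1\cup\mathcal{R}_2$, i.e. $E(t_m)\in\mathrm{int}(\mathcal{R}_1\cup\mathcal{R}_2)$, then $t_m$ is a fixed point of $t\mapsto F[E(t)]$, i.e. $t_m=F[E(t_m)]$.
   Context: Pursuer (Dubins vehicle): the state is $\boldsymbol z=(x,y,\theta)\in\mathbb{R}^2\times\mathbb{S}^1$ with dynamics $\dot x=\cos\theta$, $\dot y=\sin\theta$, $\dot\theta=u/\rho$, where $u(\cdot)$ is a measurable control with values in $[-1,1]$ and $\rho>0$ is the minimum turning radius. The initial configuration at $t=0$ is $\boldsymbol z_0=(0,0,\pi/2)$. Target: its velocity is $\boldsymbol v(t)=(v_x(t),v_y(t))$ (a given function of time), its initial position is $(\hat x_0,\hat y_0)$, and its position is $E(t)=(\hat x_0,\hat y_0)+\int_0^t\boldsymbol v(\tau)\,d\tau$ for $t\ge 0$. Standing assumption: $\|\boldsymbol v\|<1$ (Euclidean norm), so that the MTIP has a solution. MTIP: find the minimum time $t_m>0$ such that some measurable control $u(\cdot)$ on $[0,t_m]$ steers the pursuer from $\boldsymbol z_0$ at $t=0$ to intercept the target at $t_m$, i.e. $(x(t_m),y(t_m))=E(t_m)$ (final heading free). $F[x,y]$ for $(x,y)\in\mathbb{R}^2$ is the minimum time (equivalently, since the speed is $1$, the length of the shortest path) for the pursuer to move from $\boldsymbol z_0$ to the point $(x,y)$ with free final heading. Regions: $\mathcal{D}_r=\{(x-\rho)^2+y^2\le\rho^2\}$,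 $\mathcal{D}_l=\{(x+\rho)^2+y^2\le\rho^2\}$, $\mathcal{R}_2=\mathcal{D}_r\cup\mathcal{D}_l$, $\mathcal{R}_3=\{(x,y)\in\mathbb{R}^2: y>0,\ (x-\rho)^2+y^2\le 9\rho^2,\ (x+\rho)^2+y^2\le 9\rho^2\}\setminus(\mathcal{R}_2\cap\{y>0\})$, and $\mathcal{R}_1=\mathbb{R}^2\setminus(\mathcal{R}_2\cup\mathcal{R}_3)$. *)

(* Defs.v *)
From HB Require Import structures.
From mathcomp Require Import all_boot all_order all_algebra.
From mathcomp Require Import all_classical all_reals all_analysis.

Set Implicit Arguments.
Unset Strict Implicit.
Unset Printing Implicit Defensive.

Import Order.TTheory GRing.Theory Num.Theory.
Import numFieldNormedType.Exports.

Local Open Scope classical_set_scope.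
Local Open Scope ring_scope.

Definition admissible_control (R : realType) (T : R) (u : R -> R) : Prop :=
  measurable_fun `[0, T] u /\
  (forall t, 0 <= t <= T -> -1 <= u t <= 1).

(* Caratheodory solution on [0, T], in integral form, of
     x' = cos theta,  y' = sin theta,  theta' = u / rho
   from (0, 0, pi / 2). The heading, an element of the circle, is represented
   by its continuous real lift starting at pi / 2. *)
Definition dubins_trajectory (R : realType) (rho T : R)
    (u x y theta : R -> R) : Prop :=
  forall t, 0 <= t <= T ->
    [/\ x t = \int[lebesgue_measure]_(s in `[0, t]) cos (theta s),
        y t = \int[lebesgue_measure]_(s in `[0, t]) sin (theta s) &
        theta t = pi / 2 + \int[lebesgue_measure]_(s in `[0, t]) (u s / rho)].

(* The speed is 1, so this is reachability at time exactly T; the final heading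
   is free. *)
Definition reaches (R : realType) (rho T : R) (p : R * R) : Prop :=
  exists u x y theta : R -> R,
    [/\ admissible_control T u,
        dubins_trajectory rho T u x y theta &
        (x T, y T) = p].

(* The infimum is over a nonempty set bounded below whenever p is reachable,
   and equals the minimum when the latter is attained. *)
Definition min_time (R : realType) (rho : R) (p : R * R) : R :=
  inf [set T : R | 0 <= T /\ reaches rho T p].

Definition target_pos (R : realType) (x0 y0 : R) (vx vy : R -> R) (t : R) :
    R * R :=
  (x0 + \int[lebesgue_measure]_(s in `[0, t]) vx s,
   y0 + \int[lebesgue_measure]_(s in `[0, t]) vy s).

Definition is_min_intercept_time (R : realType) (rho : R) (E : R -> R * R)
    (tm : R) : Prop :=
  [/\ 0 < tm,
      reaches rho tm (E tm) &
      forall t, 0 < t -> reaches rho t (E t) -> tm <= t].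

Definition disk_r (R : realType) (rho : R) : set (R * R) :=
  [set p | (p.1 - rho) ^+ 2 + p.2 ^+ 2 <= rho ^+ 2].

Definition disk_l (R : realType) (rho : R) : set (R * R) :=
  [set p | (p.1 + rho) ^+ 2 + p.2 ^+ 2 <= rho ^+ 2].

Definition region2 (R : realType) (rho : R) : set (R * R) :=
  disk_r rho `|` disk_l rho.

Definition region3 (R : realType) (rho : R) : set (R * R) :=
  [set p | [/\ 0 < p.2,
               (p.1 - rho) ^+ 2 + p.2 ^+ 2 <= 9 * rho ^+ 2 &
               (p.1 + rho) ^+ 2 + p.2 ^+ 2 <= 9 * rho ^+ 2]]
  `\` (region2 rho `&` [set p | 0 < p.2]).

Definition region1 (R : realType) (rho : R) : set (R * R) :=
  ~` (region2 rho `|` region3 rho).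

(* Main.v *)
Require Import Defs.
From mathcomp Require Import all_boot all_order all_algebra.
From mathcomp Require Import all_classical all_reals all_analysis.
From mathcomp Require Import measurable_realfun ring lra.
Set Implicit Arguments.
Unset Strict Implicit.
Unset Printing Implicit Defensive.
Import Order.TTheory GRing.Theory Num.Theory.
Import numFieldNormedType.Exports.
Local Open Scope classical_set_scope.
Local Open Scope ring_scope.

(** Work in the frame of the vehicle with turning radius 1, where the target lies
    at w = (wx, wy). If the target is outside both turning disks, the shortest path
    is an arc followed by a tangent segment; inside one of them it is an arc of the
    other circle followed by an arc of the disk itself. The explicit lengths V of
    these paths are lower bounds for every trajectory because V (w (t)) + t is
    nondecreasing along the motion (or by calibration, when the target is ahead).
    Conversely, off region 3 every length T >= V is realised exactly: a preliminary
    arc or segment of length a followed by the explicit path from there has length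
    a + V (w (a)), which is continuous in a, starts at V and is unbounded.

    If E (tm) could be reached at some T < tm, then V (E (tm)) <= T < tm; as V is
    continuous near E (tm), V (E (t)) < t for t < tm close to tm, so the target would
    be intercepted at time t < tm, contradicting the minimality of tm. *)

(** * First-order calculus along a Lipschitz heading *)

Section ControlDerivative.
Context {R : realType}.
Implicit Types (f g th : R -> R) (t A B : R).

(** Region 3 is left out because V jumps across the upper half of the boundary of a turning disk. A
    preliminary left turn rotates the target about (-1, 0), and only beyond distance 3, the largest
    distance from (-1, 0) to a point of the right disk, is the target certain to avoid that disk;
    hence the constant 9. Across the lower half of the boundary the two formulas for V agree
    ([VL_boundary]). A point of the interior of the union of regions 1 and 2 is not a limit of
    points of region 3. After a reflection making wx >= 0, three cases remain: the target in the
    open right disk, outside it with wy < 0, or farther than 3 from (-1, 0). Controls are merely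
    measurable, so the heading need not be differentiable. The lower bounds avoid almost-everywhere
    derivatives: if a quantity varies by A h + B dth to first order, then |dth| <= h makes it
    nondecreasing as soon as |B| <= A. *)

Definition lip1 th := forall s t : R, `|th s - th t| <= `|s - t|.

(* The heading th is only Lipschitz: functions of the state are expanded to
   first order in the time increment and in the increment of th. *)
Definition is_cderive th t f A B :=
  forall e, 0 < e -> \forall h \near 0^'+,
    `|f (t + h) - f t - A * h - B * (th (t + h) - th t)| <= e * h.

Lemma is_cderive_eq th t f A B A' B' :
  is_cderive th t f A' B' -> A' = A -> B' = B -> is_cderive th t f A B.
Proof. by move=> ? <- <-. Qed.

Lemma is_cderive_cst th t c : is_cderive th t (fun=> c) 0 0.
Proof.
move=> e e0; near=> h.
by rewrite subrr !mul0r !subr0 normr0 mulr_ge0 // ltW.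
Unshelve. all: by end_near. Qed.

Lemma is_cderive_id th t : is_cderive th t id 1 0.
Proof.
move=> e e0; near=> h.
rewrite mul1r mul0r subr0 [t + h]addrC addrK subrr normr0.
by rewrite mulr_ge0 // ltW.
Unshelve. all: by end_near. Qed.

Lemma is_cderive_th th t : is_cderive th t th 0 1.
Proof.
move=> e e0; near=> h.
by rewrite mul1r mul0r subr0 subrr normr0 mulr_ge0 // ltW.
Unshelve. all: by end_near. Qed.

Lemma is_cderiveD th t f g A B A' B' :
  is_cderive th t f A B -> is_cderive th t g A' B' ->
  is_cderive th t (fun x => f x + g x) (A + A') (B + B').
Proof.
move=> df dg e e0.
have e2 : 0 < e / 2 by rewrite divr_gt0.
have {}df := df _ e2; have {}dg := dg _ e2.
near=> h.
have -> : f (t + h) + g (t + h) - (f t + g t) - (A + A') * h -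
    (B + B') * (th (t + h) - th t) =
  (f (t + h) - f t - A * h - B * (th (t + h) - th t)) +
  (g (t + h) - g t - A' * h - B' * (th (t + h) - th t)) by ring.
rewrite (le_trans (ler_normD _ _))// [e]splitr mulrDl lerD //.
  by near: h.
by near: h.
Unshelve. all: by end_near. Qed.

Lemma is_cderive_lip th t f A B : lip1 th -> is_cderive th t f A B ->
  \forall h \near 0^'+, `|f (t + h) - f t| <= (`|A| + `|B| + 1) * h.
Proof.
move=> lth df; have {}df := df _ ltr01; near=> h.
have h0 : 0 < h by near: h; exact: nbhs_right_gt.
have lh : `|th (t + h) - th t| <= h.
  by rewrite (le_trans (lth _ _))// addrC addKr gtr0_norm.
have -> : f (t + h) - f t = (f (t + h) - f t - A * h -
   B * (th (t + h) - th t)) + A * h + B * (th (t + h) - th t) by ring.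
rewrite (le_trans (ler_normD _ _))//.
have -> : (`|A| + `|B| + 1) * h = 1 * h + `|A| * h + `|B| * h by ring.
apply: lerD; last by rewrite normrM ler_wpM2l.
rewrite (le_trans (ler_normD _ _))// lerD //; last by rewrite normrM (gtr0_norm h0).
by near: h.
Unshelve. all: by end_near. Qed.

Lemma is_derive1_expand g (x a e : R) : is_derive x 1 g a -> 0 < e ->
  \forall y \near x, `|g y - g x - a * (y - x)| <= e * `|y - x|.
Proof.
move=> dg e0.
have [G [gE cG Gx]] := (is_derive1_caratheodory g x a).1 dg.
have /cvgrPdist_le /(_ _ e0) Ge := cG.
near=> y; rewrite gE -mulrBl normrM ler_wpM2r // distrC -Gx.
by near: y.
Unshelve. all: by end_near. Qed.

Lemma is_cderive_comp th t (g f : R -> R) a A B : lip1 th ->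
  is_cderive th t f A B -> is_derive (f t) 1 g a ->
  is_cderive th t (fun x => g (f x)) (a * A) (a * B).
Proof.
move=> lth df dg e e0.
have K0 : 0 < `|A| + `|B| + 1 by rewrite ltr_wpDl // addr_ge0.
set K := `|A| + `|B| + 1 in K0.
(* Half of the error pays for the remainder of [g], amplified by the growth rate [K] of [f]; the
   other half for the remainder of [f], amplified by [a], where [+ 1] covers [a = 0]. *)
have e1 : 0 < e / (2 * K) by rewrite divr_gt0 // mulr_gt0.
have e2 : 0 < e / (2 * (`|a| + 1)).
  by rewrite divr_gt0 // mulr_gt0 // ltr_wpDl.
have /nbhs_ballP[d /= d0 Hd] := is_derive1_expand dg e1.
have lf := is_cderive_lip lth df.
have {}df := df _ e2.
near=> h.
have h0 : 0 < h by near: h; exact: nbhs_right_gt.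
have lfh : `|f (t + h) - f t| <= K * h by near: h.
have dfh : `|f (t + h) - f t - A * h - B * (th (t + h) - th t)| <=
   e / (2 * (`|a| + 1)) * h by near: h.
have hd : h < d / K by near: h; apply: nbhs_right_lt; rewrite divr_gt0.
have bf : ball (f t) d (f (t + h)).
  rewrite /ball /= distrC (le_lt_trans lfh) //.
  by rewrite mulrC -ltr_pdivlMr.
have {}Hd := Hd _ bf; rewrite /= in Hd.
set u := f (t + h) - f t in lfh dfh Hd *.
have -> : g (f (t + h)) - g (f t) - a * A * h - a * B * (th (t + h) - th t) =
  (g (f (t + h)) - g (f t) - a * u) +
  a * (u - A * h - B * (th (t + h) - th t)) by ring.
rewrite (le_trans (ler_normD _ _))// [e]splitr mulrDl lerD //.
  rewrite (le_trans Hd) //.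
  have -> : e / 2 * h = e / (2 * K) * (K * h) by field; rewrite gt_eqF.
  by rewrite ler_wpM2l // ltW.
rewrite normrM (le_trans (ler_wpM2l _ dfh)) // mulrA ler_wpM2r ?(ltW h0) //.
have a1 : 0 < `|a| + 1 by rewrite ltr_wpDl.
have -> : e / 2 = (`|a| + 1) * (e / (2 * (`|a| + 1))) by field; rewrite gt_eqF.
by rewrite ler_wpM2r ?(ltW e2) // lerDl.
Unshelve. all: by end_near. Qed.

Lemma is_cderiveZ th t f c A B : lip1 th ->
  is_cderive th t f A B -> is_cderive th t (fun x => c * f x) (c * A) (c * B).
Proof.
move=> lth df; apply: (is_cderive_comp (g := *%R c) lth df).
by apply: is_derive_eq; rewrite /GRing.scale/= mulr1.
Qed.

Lemma is_cderiveN th t f A B : lip1 th ->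
  is_cderive th t f A B -> is_cderive th t (fun x => - f x) (- A) (- B).
Proof.
move=> lth df; have := is_cderiveZ (-1) lth df.
by under eq_fun do rewrite mulN1r; rewrite !mulN1r.
Qed.

Lemma is_cderive_sqr th t f A B : lip1 th -> is_cderive th t f A B ->
  is_cderive th t (fun x => f x ^+ 2) (2 * f t * A) (2 * f t * B).
Proof.
move=> lth df; apply: (is_cderive_comp (g := fun x => x ^+ 2) lth df).
by apply: is_derive_eq; rewrite /GRing.scale/= mulr1 mulrC mulr_natr.
Qed.

(** By polarisation, 4 f g = (f + g)^2 - (f - g)^2, the product rule reduces to the chain rule for
    squares. *)
Lemma is_cderiveM th t f g A B A' B' : lip1 th ->
  is_cderive th t f A B -> is_cderive th t g A' B' ->
  is_cderive th t (fun x => f x * g x)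
    (A * g t + f t * A') (B * g t + f t * B').
Proof.
move=> lth df dg.
have := is_cderiveD
  (is_cderiveZ 4^-1 lth (is_cderive_sqr lth
    (is_cderiveD df dg)))
  (is_cderiveZ (- 4^-1) lth (is_cderive_sqr lth
    (is_cderiveD df (is_cderiveN lth dg)))).
have -> : (fun x => 4^-1 * (f x + g x) ^+ 2 + - 4^-1 * (f x - g x) ^+ 2) =
  (fun x => f x * g x) by apply/funext => x; field.
by move/is_cderive_eq; apply; field.
Qed.

Lemma is_cderiveV th t f A B : lip1 th ->
  is_cderive th t f A B -> f t != 0 ->
  is_cderive th t (fun x => (f x)^-1) (- A / f t ^+ 2) (- B / f t ^+ 2).
Proof.
move=> lth df f0.
have dg : is_derive (f t) 1 (fun x : R => x^-1) (- (f t) ^- 2).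
  apply: (is_derive_eq (@is_deriveV _ id (f t) 1 1 f0 _)).
  by rewrite /GRing.scale/= mulr1.
have /is_cderive_eq := is_cderive_comp lth df dg.
by apply; field.
Qed.

(** As the increment of [th] is at most h in absolute value, [|B| <= A] leaves only an o(h) loss.
    Adding a small slope [e] beats that loss, so the maximum of [f x + e * (x - a)] cannot be
    attained before [b]. Dividing by [b - a + 1] makes the total correction at most [e0], also when
    [a = b]. *)
Lemma is_cderive_nondecreasing th f (a b : R) : lip1 th -> a <= b ->
  {within `[a, b], continuous f} ->
  (forall t, a <= t < b ->
     exists A B, is_cderive th t f A B /\ `|B| <= A) ->
  f a <= f b.
Proof.
move=> lth ab cf df.
apply/ler_addgt0Pr => e0 e00.
pose e := e0 / (b - a + 1).
have ba1 : 0 < b - a + 1 by rewrite ltr_wpDl // subr_ge0.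
have e1 : 0 < e by rewrite divr_gt0.
pose g x := f x + e * (x - a).
have cg : {within `[a, b], continuous g}.
  move=> x; apply: cvgD; first exact: cf.
  have : {within `[a, b], continuous (fun x => e * (x - a))}.
    apply: continuous_subspaceT => y; apply: cvgMr; apply: cvgB => //.
    exact: cvg_cst.
  exact.
have [c cab gc] := EVT_max ab cg.
suff cb : c = b.
  have := gc a; rewrite in_itv /= lexx ab => /(_ isT).
  rewrite cb /g subrr mulr0 addr0 => /le_trans; apply.
  rewrite lerD2l /e mulrAC ler_pdivrMr // ler_wpM2l ?(ltW e00) //.
  by rewrite lerDl.
apply/eqP; case: eqVneq => // cb.
move: cab; rewrite in_itv /= => /andP[ac cb'].
have {cb'}cb : c < b by rewrite lt_neqAle cb.
have [|A [B [dfc BA]]] := df c; first by rewrite ac.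
have e2 : 0 < e / 2 by rewrite divr_gt0.
have {}dfc := dfc _ e2.
near (0 : R)^'+ => h.
have h0 : 0 < h by near: h; exact: nbhs_right_gt.
have hb : c + h < b.
  by rewrite -ltrBrDl; near: h; apply: nbhs_right_lt; rewrite subr_gt0.
have dh : `|f (c + h) - f c - A * h - B * (th (c + h) - th c)| <= e / 2 * h.
  by near: h.
have := gc (c + h); rewrite in_itv /= (ltW hb) (le_trans ac) ?lerDl ?(ltW h0) //.
move=> /(_ isT); rewrite /g.
have : - (A * h) <= B * (th (c + h) - th c).
  rewrite lerNl (le_trans (ler_norm _)) // normrN normrM.
  apply: ler_pM => //.
  by rewrite (le_trans (lth _ _))// addrC addKr gtr0_norm.
move: dh; rewrite ler_norml => /andP[dh _].
have : 0 < e * h by rewrite mulr_gt0.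
rewrite leNgt; lra.
Unshelve. all: by end_near. Qed.

End ControlDerivative.

(** * Explicit path lengths and their continuity *)

Section PathLengths.
Context {R : realType}.
Implicit Types x y : R.

(* Lengths, for turning radius 1, of two candidate paths from the origin with
   heading (0, 1) to (x, y). VS: a right arc on the circle of centre (1, 0), then
   a segment of length tanlen tangent to it; (rr, phir) are the polar coordinates
   of (x, y) around (1, 0). VL: a left arc on the circle of centre (-1, 0), then a
   right arc of angle pi + 2 atan (slr x y). *)
Definition rr x y : R := Num.sqrt ((x - 1) ^+ 2 + y ^+ 2).
Definition tanlen x y : R := Num.sqrt ((x - 1) ^+ 2 + y ^+ 2 - 1).
Definition phir x y : R := 2 * atan (y / (rr x y + (x - 1))).
Definition VS x y : R := pi - phir x y + (tanlen x y - atan (tanlen x y)).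

Definition dl2 x y : R := (x + 1) ^+ 2 + y ^+ 2.
Definition slr x y : R := Num.sqrt ((9 - dl2 x y) / (dl2 x y - 1)).
Definition VL x y : R :=
  atan (y / (x + 1)) + pi + (3 * atan (slr x y) - atan (slr x y / 3)).

Lemma sqrt1D_gt0 (u : R) : 0 < Num.sqrt (1 + u ^+ 2).
Proof. by rewrite sqrtr_gt0 ltr_pwDl // sqr_ge0. Qed.

Lemma sin_atan (u : R) : sin (atan u) = u / Num.sqrt (1 + u ^+ 2).
Proof.
have c0 : cos (atan u) != 0.
  by rewrite cos_atan invr_neq0 // gt_eqF // sqrt1D_gt0.
by rewrite -cos_atan -{2}[u]atanK /tan divfK.
Qed.

Lemma cos_2atan (u : R) : cos (2 * atan u) = (1 - u ^+ 2) / (1 + u ^+ 2).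
Proof.
have n0 : 1 + u ^+ 2 != 0 by rewrite gt_eqF // ltr_pwDl // sqr_ge0.
rewrite mulr_natl mulr2n cosD cos_atan sin_atan.
have s2 : Num.sqrt (1 + u ^+ 2) ^+ 2 = 1 + u ^+ 2.
  by rewrite sqr_sqrtr // addr_ge0 // sqr_ge0.
have s0 := lt0r_neq0 (sqrt1D_gt0 u).
rewrite -[in RHS]s2.
by field.
Qed.

Lemma sin_2atan (u : R) : sin (2 * atan u) = 2 * u / (1 + u ^+ 2).
Proof.
have s2 : Num.sqrt (1 + u ^+ 2) ^+ 2 = 1 + u ^+ 2.
  by rewrite sqr_sqrtr // addr_ge0 // sqr_ge0.
have s0 := lt0r_neq0 (sqrt1D_gt0 u).
rewrite mulr_natl mulr2n sinD cos_atan sin_atan -[in RHS]s2.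
by field.
Qed.

Lemma atan_ge0 (u : R) : 0 <= u -> 0 <= atan u.
Proof. by move=> u0; rewrite -atan0 le_atan. Qed.

Lemma rr_ge0 x y : 0 <= rr x y. Proof. exact: sqrtr_ge0. Qed.

Lemma rr2 x y : rr x y ^+ 2 = (x - 1) ^+ 2 + y ^+ 2.
Proof. by rewrite sqr_sqrtr // addr_ge0 // sqr_ge0. Qed.

Lemma tanlen2 x y : 1 <= (x - 1) ^+ 2 + y ^+ 2 ->
  tanlen x y ^+ 2 = (x - 1) ^+ 2 + y ^+ 2 - 1.
Proof. by move=> h; rewrite sqr_sqrtr // subr_ge0. Qed.

Lemma tanlen_ge0 x y : 0 <= tanlen x y. Proof. exact: sqrtr_ge0. Qed.

(** The half-angle formula for the polar angle breaks down only on the ray y = 0, x <= 1, where its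
    denominator vanishes. *)
Lemma rr_dom_y x y : y != 0 -> 0 < rr x y + (x - 1).
Proof.
move=> y0; have := rr2 x y; have := rr_ge0 x y.
have : 0 < y ^+ 2 by rewrite exprn_even_gt0.
set r := rr x y; nra.
Qed.

Lemma rr_dom x y : 0 <= x -> 1 <= (x - 1) ^+ 2 + y ^+ 2 ->
  (x, y) != (0, 0) -> 0 < rr x y + (x - 1).
Proof.
move=> x0 r1 xy0; have [y0|/rr_dom_y //] := eqVneq y 0.
have {xy0} xn0 : 0 < x.
  by rewrite lt_neqAle x0 andbT eq_sym; apply: contraNneq xy0 => ->; rewrite y0.
have := rr_ge0 x y; move: r1; rewrite y0 expr0n /= addr0; nra.
Qed.

Section Tangent.
Variables x y : R.
Hypothesis r1 : 1 <= (x - 1) ^+ 2 + y ^+ 2.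
Hypothesis dom : 0 < rr x y + (x - 1).

Lemma rr_gt0 : 0 < rr x y.
Proof. by rewrite lt_neqAle rr_ge0 andbT eq_sym sqrtr_eq0 -ltNge (lt_le_trans ltr01). Qed.

Lemma cos_phir : rr x y * cos (phir x y) = x - 1.
Proof.
rewrite cos_2atan; have := rr2 x y; have := rr_gt0; have := dom.
set r := rr x y => d r0 e.
have dn := lt0r_neq0 d.
have -> : 1 + (y / (r + (x - 1))) ^+ 2 = 2 * r / (r + (x - 1)).
  have y2 : y ^+ 2 = r ^+ 2 - (x - 1) ^+ 2 by rewrite e; ring.
  by rewrite expr_div_n y2; field.
have -> : 1 - (y / (r + (x - 1))) ^+ 2 = 2 * (x - 1) / (r + (x - 1)).
  have y2 : y ^+ 2 = r ^+ 2 - (x - 1) ^+ 2 by rewrite e; ring.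
  by rewrite expr_div_n y2; field.
by field; rewrite dn gt_eqF.
Qed.

Lemma sin_phir : rr x y * sin (phir x y) = y.
Proof.
rewrite sin_2atan; have := rr2 x y; have := rr_gt0; have := dom.
set r := rr x y => d r0 e.
have dn := lt0r_neq0 d.
have -> : 1 + (y / (r + (x - 1))) ^+ 2 = 2 * r / (r + (x - 1)).
  have y2 : y ^+ 2 = r ^+ 2 - (x - 1) ^+ 2 by rewrite e; ring.
  by rewrite expr_div_n y2; field.
by field; rewrite dn gt_eqF.
Qed.

Lemma sqrt1D_tanlen : Num.sqrt (1 + tanlen x y ^+ 2) = rr x y.
Proof. by rewrite tanlen2 // addrC subrK. Qed.

(** Angle of the initial arc. Seen from (1, 0), a right turn starts at polar angle [pi] and runs
    clockwise to the tangency point, at [phir x y + atan (tanlen x y)]. *)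
Definition arcS := pi - phir x y - atan (tanlen x y).

(** The arc ends at (1 - cos [arcS], sin [arcS]) with heading (sin [arcS], cos [arcS]); the segment
    then adds [tanlen x y] times this heading. *)
Lemma tangent_x : x - 1 = - cos arcS + tanlen x y * sin arcS.
Proof.
rewrite -cos_phir /arcS -addrA -opprD.
rewrite [pi - _]addrC cosDpi sinDpi cosN sinN !opprK.
rewrite sinD cosD cos_atan sin_atan sqrt1D_tanlen.
have := tanlen2 r1; have := rr2 x y; have := rr_gt0.
set r := rr x y; set m := tanlen x y => r0 e1 e2.
have {}e2 : m ^+ 2 = r ^+ 2 - 1 by rewrite e2 e1.
have rn := lt0r_neq0 r0.
set c := cos _; set s := sin _.
have -> : c * r^-1 - s * (m / r) + m * (s * r^-1 + c * (m / r)) =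
  c * (1 + m ^+ 2) / r by field.
by rewrite e2; field.
Qed.

Lemma tangent_y : y = sin arcS + tanlen x y * cos arcS.
Proof.
rewrite -{1}sin_phir /arcS -addrA -opprD.
rewrite [pi - _]addrC cosDpi sinDpi cosN sinN !opprK.
rewrite sinD cosD cos_atan sin_atan sqrt1D_tanlen.
have := tanlen2 r1; have := rr2 x y; have := rr_gt0.
set r := rr x y; set m := tanlen x y => r0 e1 e2.
have {}e2 : m ^+ 2 = r ^+ 2 - 1 by rewrite e2 e1.
have rn := lt0r_neq0 r0.
set c := cos _; set s := sin _.
have -> : s * r^-1 + c * (m / r) + m * - (c * r^-1 - s * (m / r)) =
  s * (1 + m ^+ 2) / r by field.
by rewrite e2; field.
Qed.

(** A negative arc means [pi - phir x y < atan (tanlen x y)]; taking cosines gives 1 / r < (1 - x) /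
    r with r = [rr x y], that is x < 0. *)
Lemma arcS_ge0 : 0 <= x -> 0 <= arcS.
Proof.
move=> x0; rewrite leNgt; apply/negP => al0.
have p0 : phir x y < pi.
  have := atan_ltpi2 (y / (rr x y + (x - 1))).
  by rewrite /phir; lra.
have ps0 := atan_ge0 (tanlen_ge0 x y).
have ps1 := atan_ltpi2 (tanlen x y).
have pp := pi_gt0 R.
have lt1 : pi - phir x y < atan (tanlen x y) by move: al0; rewrite /arcS; lra.
have cc : cos (atan (tanlen x y)) < cos (pi - phir x y).
  rewrite ltr_cos // in_itv /=; lra.
have := cos_phir.
have c1 : cos (pi - phir x y) = - cos (phir x y).
  by rewrite addrC cosDpi cosN.
move: cc; rewrite c1 cos_atan sqrt1D_tanlen => cc e.
have : rr x y * (rr x y)^-1 = 1 by rewrite mulfV // gt_eqF // rr_gt0.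
have : rr x y * (rr x y)^-1 < rr x y * - cos (phir x y).
  by rewrite ltr_pM2l // rr_gt0.
by rewrite mulrN e; lra.
Qed.

Lemma VS_arcS : VS x y = arcS + tanlen x y.
Proof. by rewrite /VS /arcS; ring. Qed.

End Tangent.

Lemma cvg_sqr {T : Type} {F : set_system T} {FF : Filter F} (f : T -> R) (a : R) :
  f x @[x --> F] --> a -> f x ^+ 2 @[x --> F] --> a ^+ 2.
Proof.
by apply: (@continuous_cvg _ _ _ _ _ f (fun z : R => z ^+ 2)); apply: exprn_continuous.
Qed.

Lemma cvg_sqrt {T : Type} {F : set_system T} {FF : Filter F} (f : T -> R) (a : R) :
  f x @[x --> F] --> a -> Num.sqrt (f x) @[x --> F] --> Num.sqrt a.
Proof. by apply: (@continuous_cvg _ _ _ _ _ f Num.sqrt); apply: sqrt_continuous. Qed.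

Lemma cvg_atan {T : Type} {F : set_system T} {FF : Filter F} (f : T -> R) (a : R) :
  f x @[x --> F] --> a -> atan (f x) @[x --> F] --> atan a.
Proof. by apply: (@continuous_cvg _ _ _ _ _ f atan); apply: continuous_atan. Qed.

Lemma cvg_VS {T : Type} {F : set_system T} {FF : Filter F} (f g : T -> R) (a b : R) :
  0 < rr a b + (a - 1) -> f x @[x --> F] --> a -> g x @[x --> F] --> b ->
  VS (f x) (g x) @[x --> F] --> VS a b.
Proof.
move=> d fa gb.
have fa1 : f x - 1 @[x --> F] --> a - 1 by apply: cvgB fa _; exact: cvg_cst.
have q : (f x - 1) ^+ 2 + g x ^+ 2 @[x --> F] --> (a - 1) ^+ 2 + b ^+ 2.
  apply: cvgD.
    exact: cvg_sqr.
  exact: cvg_sqr.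
have rc : rr (f x) (g x) @[x --> F] --> rr a b.
  exact: cvg_sqrt.
have tc : tanlen (f x) (g x) @[x --> F] --> tanlen a b.
  apply: cvg_sqrt; apply: cvgB => //; exact: cvg_cst.
have ac : atan (tanlen (f x) (g x)) @[x --> F] --> atan (tanlen a b).
  exact: cvg_atan.
apply: cvgD; last exact: cvgB.
apply: cvgB; first exact: cvg_cst.
apply: cvgM; first exact: cvg_cst.
apply: cvg_atan.
apply: cvgM => //; apply: cvgV; first by rewrite gt_eqF.
exact: cvgD.
Qed.

Lemma cvg_VL {T : Type} {F : set_system T} {FF : Filter F} (f g : T -> R) (a b : R) :
  0 < a + 1 -> 1 < dl2 a b -> f x @[x --> F] --> a -> g x @[x --> F] --> b ->
  VL (f x) (g x) @[x --> F] --> VL a b.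
Proof.
move=> a1 d1 fa gb.
have fa1 : f x + 1 @[x --> F] --> a + 1 by apply: cvgD fa _; exact: cvg_cst.
have q : dl2 (f x) (g x) @[x --> F] --> dl2 a b.
  apply: cvgD.
    exact: cvg_sqr.
  exact: cvg_sqr.
have sc : slr (f x) (g x) @[x --> F] --> slr a b.
  apply: cvg_sqrt; apply: cvgM.
    by apply: cvgB => //; exact: cvg_cst.
  apply: cvgV; first by rewrite subr_eq0 gt_eqF.
  by apply: cvgB => //; exact: cvg_cst.
apply: cvgD.
  apply: cvgD; last exact: cvg_cst.
  apply: cvg_atan.
  apply: cvgM => //; apply: cvgV => //; by rewrite gt_eqF.
apply: cvgB.
  apply: cvgM; first exact: cvg_cst.
  exact: cvg_atan.
apply: cvg_atan.
by apply: cvgM => //; exact: cvg_cst.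
Qed.

(** With [u = tanlen x y], this is the part of [VS] that depends only on the distance to the turning
    centre. *)
Lemma tan_atan_id_le (u v : R) : 0 <= u -> u <= v -> u - atan u <= v - atan v.
Proof.
move=> u0 uv.
have df (x : R) : is_derive x 1 (fun z : R => z - atan z) (1 - (1 + x ^+ 2)^-1).
  exact: is_deriveB.
have [|c _] := MVT_segment uv (fun x _ => df x).
  apply: continuous_subspaceT => x.
  by apply: cvgB => //; exact: continuous_atan.
move=> e; rewrite -subr_ge0 e mulr_ge0 ?subr_ge0 // invf_le1 ?lerDl ?sqr_ge0 //.
by rewrite ltr_pwDl ?sqr_ge0.
Qed.

End PathLengths.

(** * Motion of the target in the frame of the vehicle *)

Section BodyFrame.
Context {R : realType}.
Implicit Types (th wx wy : R -> R) (T : R).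

(* (wx, wy) is the position of a fixed target in the frame of the vehicle: wy is
   the coordinate along the heading and wx the coordinate to its right; th is
   the heading and the turning radius is 1. *)
Record body_path th wx wy T : Prop := BodyPath {
  body_lip : lip1 th;
  body_cx : continuous wx;
  body_cy : continuous wy;
  body_dx : forall t, 0 <= t < T -> is_cderive th t wx 0 (wy t);
  body_dy : forall t, 0 <= t < T -> is_cderive th t wy (- 1) (- wx t) }.

Lemma body_path_mirror th wx wy T : body_path th wx wy T ->
  body_path (fun s => - th s) (fun s => - wx s) wy T.
Proof.
case=> lth cx cy dx dy; split => //.
- by move=> s t; rewrite -opprD normrN.
- by move=> t; apply: cvgN; exact: cx.
- move=> t /dx d e e0; have {}d := d _ e0; near=> h.
  rewrite -normrN mul0r.
  have -> : - (- wx (t + h) - - wx t - 0 - wy t * (- th (t + h) - - th t)) =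
    wx (t + h) - wx t - 0 * h - wy t * (th (t + h) - th t) by ring.
  by near: h.
- move=> t /dy d e e0; have {}d := d _ e0; near=> h.
  have -> : wy (t + h) - wy t - - 1 * h - - - wx t * (- th (t + h) - - th t) =
    wy (t + h) - wy t - - 1 * h - - wx t * (th (t + h) - th t) by ring.
  by near: h.
Unshelve. all: by end_near. Qed.

Lemma cos_le_arc (b psi : R) : 0 <= b -> b <= psi -> psi <= 2 * pi - b ->
  cos psi <= cos b.
Proof.
move=> b0 bp pb; have pp := pi_gt0 R.
have [pl|pl] := leP psi pi.
  by rewrite leNgt ltr_cos ?in_itv /=; lra.
have -> : cos psi = cos (2 * pi - psi).
  by rewrite -[RHS]cosN opprB -[RHS]cosD2pi mulr_natl subrK.
by rewrite leNgt ltr_cos ?in_itv /=; lra.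
Qed.

Lemma first_hit (f : R -> R) (a b : R) : a <= b -> continuous f ->
  f a < 0 -> 0 <= f b ->
  exists c, [/\ a < c, c <= b, f c = 0 & forall s, a <= s < c -> f s < 0].
Proof.
move=> ab cf fa fb.
pose A := [set s | a <= s <= b /\ 0 <= f s].
have Ab : A b by split => //; rewrite ab lexx.
have lbA : lbound A a by move=> s [/andP[]].
have hiA : has_inf A by split; [exists b | exists a].
pose c := inf A.
have ac : a <= c by apply: lb_le_inf => //; exists b.
have cb : c <= b by apply: ge_inf => //; exists a.
have below s : a <= s < c -> f s < 0.
  move=> /andP[as' sc]; rewrite ltNge; apply/negP => fs.
  have : c <= s; last by rewrite leNgt sc.
  by apply: ge_inf; [exists a | split => //; rewrite as' (le_trans (ltW sc))].
have fc0 : 0 <= f c.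
  rewrite leNgt; apply/negP => fc.
  have /cvgrPdist_lt /(_ (- f c)) := cf c.
  rewrite oppr_gt0 => /(_ fc) /nbhs_ballP[d /= d0 Hd].
  have [s As sd] := inf_adherent d0 hiA.
  have cs : c <= s by apply: ge_inf => //; exists a.
  have := Hd s; rewrite /ball /= distrC ger0_norm ?subr_ge0 // ltrBlDl.
  move=> /(_ sd); rewrite distrC => /(le_lt_trans (ler_norm _)).
  by rewrite ltrBlDr addNr; case: As => _; rewrite leNgt => /negP.
have ac' : a < c.
  rewrite lt_neqAle ac andbT; apply: contraTneq fa => ->.
  by rewrite -leNgt.
exists c; split => //.
apply/eqP; rewrite eq_le fc0 andbT leNgt; apply/negP => fc.
have /cvgrPdist_lt /(_ _ fc) /nbhs_ballP[d /= d0 Hd] := cf c.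
pose s := Num.max a (c - d / 2).
have sc : s < c.
  by rewrite gt_max ac' /= ltrBlDr ltrDl divr_gt0.
have as' : a <= s by rewrite le_max lexx.
have := below s; rewrite as' sc => /(_ isT).
have sd : c - d < s.
  by rewrite lt_max; apply/orP; right; rewrite ltrD2l ltrN2 gtr_pMr // invf_lt1 // ltr1n.
have := Hd s; rewrite /ball /= ger0_norm ?subr_ge0 ?(ltW sc) // ltrBlDr -ltrBlDl.
move=> /(_ sd) /(le_lt_trans (ler_norm _)).
by rewrite ltrBlDr ltrDl => f0 f1; move: (lt_trans f0 f1); rewrite ltxx.
Qed.

Lemma continuous_within (f : R -> R) (a b : R) :
  (forall t, a <= t <= b -> {for t, continuous f}) ->
  {within `[a, b], continuous f}.
Proof.
move=> cf; apply: continuous_in_subspaceT => t.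
by rewrite inE /= in_itv /=; exact: cf.
Qed.

Section Along.
Variables (th wx wy : R -> R) (T : R).
Hypothesis W : body_path th wx wy T.

Let lth : lip1 th := body_lip W.

(* The coordinate of the target along the fixed direction of heading th t0 - al. *)
Lemma is_cderive_along (t0 al t : R) : 0 <= t < T ->
  is_cderive th t
   (fun t => wy t * cos (th t - th t0 + al) + wx t * sin (th t - th t0 + al))
   (- cos (th t - th t0 + al)) 0.
Proof.
move=> tT; have dx := body_dx W tT; have dy := body_dy W tT.
have dp : is_cderive th t (fun t => th t + (- th t0 + al)) 0 1.
  by apply: (is_cderive_eq (is_cderiveD (is_cderive_th _ _) (is_cderive_cst _ _ _)));
    rewrite addr0.
under eq_fun do rewrite -!addrA.
rewrite -!addrA.
have dc := is_cderive_comp (g := cos) lth dp (is_derive_cos _).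
have ds := is_cderive_comp (g := sin) lth dp (is_derive_sin _).
have := is_cderiveD (is_cderiveM lth dy dc) (is_cderiveM lth dx ds).
by move/is_cderive_eq; apply; ring.
Qed.

Lemma continuous_along (t0 al : R) :
  continuous (fun t => wy t * cos (th t - th t0 + al) + wx t * sin (th t - th t0 + al)).
Proof.
have cth : continuous th.
  move=> t; apply/cvgrPdist_le => e e0; near=> s.
  apply: (le_trans (lth _ _)); near: s.
  by move: e e0; apply/cvgrPdist_le; exact: cvg_id.
have cp : continuous (fun t => th t - th t0 + al).
  move=> t; apply: cvgD; last exact: cvg_cst.
  by apply: cvgB; [exact: cth|exact: cvg_cst].
move=> t; apply: cvgD; apply: cvgM; try exact: (body_cx W); try exact: (body_cy W).
  apply: (@continuous_cvg _ _ _ _ _ (fun t => th t - th t0 + al) cos); last exact: cp.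
  exact: continuous_cos.
apply: (@continuous_cvg _ _ _ _ _ (fun t => th t - th t0 + al) sin); last exact: cp.
exact: continuous_sin.
Unshelve. all: by end_near. Qed.

End Along.
End BodyFrame.

(** * Lower bound for a target ahead *)

Section TangentBound.
Context {R : realType}.
Implicit Types (th wx wy : R -> R) (T a : R).

(* Calibration by the projection q of the target on the final direction of the
   tangent path: as long as th has not had time to turn by the angle al <= pi, q
   decreases no faster than along the right turn; afterwards, no faster than at
   unit speed. *)
Lemma VS_front_le th wx wy T a : body_path th wx wy T ->
  wx T = 0 -> wy T = 0 -> 0 <= a <= T ->
  0 <= wx a -> 0 <= wy a -> (wx a, wy a) != (0, 0) ->
  1 <= (wx a - 1) ^+ 2 + wy a ^+ 2 -> VS (wx a) (wy a) <= T - a.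
Proof.
move=> W ex ey /andP[a0 aT] xa ya n0 r1; have lth := body_lip W.
have dom := rr_dom xa r1 n0.
rewrite VS_arcS.
set al := arcS (wx a) (wy a); set m := tanlen (wx a) (wy a).
have al0 : 0 <= al by exact: arcS_ge0.
have m0 : 0 <= m := tanlen_ge0 _ _.
(* A target ahead has [phir >= 0]. With [al <= pi], the angles from al - s to al + s that the
   heading can make with the final direction after time s <= al lie between al - s and 2 pi - (al -
   s), so the right turn has the largest cosine. *)
have al1 : al <= pi.
  rewrite /al /arcS; have := atan_ge0 (tanlen_ge0 (wx a) (wy a)).
  have : 0 <= phir (wx a) (wy a).
    by rewrite mulr_ge0 // atan_ge0 // divr_ge0 // ltW.
  by lra.
have pp := pi_gt0 R.
pose q t := wy t * cos (th t - th a + al) + wx t * sin (th t - th a + al).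
have cq : continuous q by exact: (@continuous_along _ _ _ _ _ W a al).
have qa : q a = sin al + m.
  rewrite /q subrr add0r.
  have -> : wx a = 1 - cos al + m * sin al.
    have -> : wx a = wx a - 1 + 1 by ring.
    by rewrite (tangent_x r1 dom) -/al -/m; ring.
  rewrite (tangent_y r1 dom) -/al -/m.
  have -> : (sin al + m * cos al) * cos al + (1 - cos al + m * sin al) * sin al =
    sin al + m * (cos al ^+ 2 + sin al ^+ 2) by ring.
  by rewrite cos2Dsin2 mulr1.
have qT : q T = 0 by rewrite /q ex ey !mul0r addr0.
have dq t : 0 <= t < T -> is_cderive th t q (- cos (th t - th a + al)) 0.
  exact: is_cderive_along.
have hth t : a <= t -> - (t - a) <= th t - th a <= t - a.
  by move=> at'; rewrite -ler_norml (le_trans (lth _ _)) // ger0_norm // subr_ge0.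
have early c : a <= c -> c <= T -> c <= a + al -> q a - sin al <= q c - sin (al - (c - a)).
  move=> ac cT cal.
  pose f t := q t + - sin (- t + (a + al)).
  have -> : q c - sin (al - (c - a)) = f c by rewrite /f; congr (_ - sin _); ring.
  have -> : q a - sin al = f a by rewrite /f; congr (_ - sin _); ring.
  apply: (is_cderive_nondecreasing lth ac).
    apply: continuous_within => t _; apply: cvgD; first exact: cq.
    apply: cvgN.
    apply: (@continuous_cvg _ _ _ _ _ (fun t => - t + (a + al)) sin); first exact: continuous_sin.
    by apply: cvgD; [apply: cvgN|exact: cvg_cst].
  move=> t /andP[at' tc].
  have tT : 0 <= t < T by rewrite (le_trans a0 at') (lt_le_trans tc).
  have /andP[h1 h2] := hth _ at'.
  have dl : is_cderive th t (fun t => - t + (a + al)) (-1) 0.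
    have /is_cderive_eq := is_cderiveD (is_cderiveN lth (is_cderive_id th t))
      (is_cderive_cst th t (a + al)).
    by apply; ring.
  have ds := is_cderiveN lth (is_cderive_comp (g := sin) lth dl (is_derive_sin _)).
  exists (- cos (th t - th a + al) + cos (- t + (a + al))), 0; split.
    by have /is_cderive_eq := is_cderiveD (dq _ tT) ds; apply; ring.
  rewrite normr0 addrC subr_ge0; apply: cos_le_arc; lra.
(* A trajectory of length at most [al] gives m + sin (al - (T - a)) <= 0 with both terms
   nonnegative. Hence m = 0 and al - (T - a) is 0 or pi; the latter forces T = a, with the target at
   the vehicle. *)
have [Tal|Tal] := leP T (a + al).
  have := early T aT (lexx T) Tal; rewrite qa qT.
  have s0 : 0 <= sin (al - (T - a)) by apply: sin_ge0_pi; lra.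
  have -> : sin al + m - sin al = m by ring.
  rewrite sub0r => ms.
  have mz : m = 0 by lra.
  have sz : sin (al - (T - a)) = 0 by lra.
  rewrite mz addr0.
  have [//|lt1] := leP al (T - a).
  have [/eqP|ne1] := eqVneq (al - (T - a)) pi.
    move=> /eqP e1; have Ta : T = a by lra.
    by move: n0; rewrite -Ta ex ey eqxx.
  have : 0 < sin (al - (T - a)).
    by apply: sin_gt0_pi; rewrite subr_gt0 lt1 /= lt_neqAle ne1 /=; lra.
  by rewrite sz ltxx.
have aal : a <= a + al by lra.
have := early _ aal (ltW Tal) (lexx _); rewrite qa.
have -> : al - (a + al - a) = 0 by ring.
rewrite sin0 => e1.
have : q (a + al) + (a + al) <= q T + T.
  apply: (is_cderive_nondecreasing (f := fun t => q t + t) lth (ltW Tal)).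
    by apply: continuous_within => t _; apply: cvgD; first exact: cq.
  move=> t /andP[at' tT].
  have tT' : 0 <= t < T by rewrite tT andbT; lra.
  exists (- cos (th t - th a + al) + 1), 0; split.
    by have /is_cderive_eq := is_cderiveD (dq _ tT') (is_cderive_id th t); apply; ring.
  by rewrite normr0 addrC subr_ge0 cos_le1.
by rewrite qT; lra.
Qed.

End TangentBound.

(** * Distance from the target to the turning centres *)

Section DiskMonotone.
Context {R : realType}.
Implicit Types (th wx wy : R -> R) (T : R).

Lemma is_cderive_dist2 th wx wy T t c : body_path th wx wy T -> 0 <= t < T ->
  is_cderive th t (fun t => (wx t - c) ^+ 2 + wy t ^+ 2)
    (- (2 * wy t)) (- (2 * c * wy t)).
Proof.
move=> W tT; have lth := body_lip W.
have dx := is_cderive_sqr lth (is_cderiveD (body_dx W tT) (is_cderive_cst th t (- c))).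
have := is_cderiveD dx (is_cderive_sqr lth (body_dy W tT)).
by move/is_cderive_eq; apply; ring.
Qed.

Lemma continuous_dist2 th wx wy T c : body_path th wx wy T ->
  continuous (fun t => (wx t - c) ^+ 2 + wy t ^+ 2).
Proof.
move=> W t; apply: cvgD; apply: cvg_sqr; last exact: (body_cy W).
by apply: cvgB; [exact: (body_cx W)|exact: cvg_cst].
Qed.

(** To first order the squared distance to (c, 0) varies by - 2 wy (h + c dth), and |c dth| <= h:
    the sign of [wy] alone decides, for both turning centres at once. *)
Lemma dist2_nondecreasing th wx wy T c a b : body_path th wx wy T ->
  `|c| <= 1 -> 0 <= a -> a <= b -> b <= T -> (forall t, a <= t < b -> wy t <= 0) ->
  (wx a - c) ^+ 2 + wy a ^+ 2 <= (wx b - c) ^+ 2 + wy b ^+ 2.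
Proof.
move=> W c1 a0 ab bT y0.
pose f t := (wx t - c) ^+ 2 + wy t ^+ 2.
apply: (is_cderive_nondecreasing (f := f) (body_lip W) ab).
  by apply: continuous_within => t _; exact: (@continuous_dist2 th wx wy T c W t).
move=> t /[dup] tab /andP[at' tb].
exists (- (2 * wy t)), (- (2 * c * wy t)); split.
  have tT : 0 <= t < T by rewrite (le_trans a0) //= (lt_le_trans tb).
  exact: (is_cderive_dist2 c W tT).
have := y0 t tab => y0t.
rewrite normrN !normrM (ler0_norm y0t) ger0_norm //.
have := normr_ge0 c; nra.
Qed.

Lemma dist2_nonincreasing th wx wy T c a b : body_path th wx wy T ->
  `|c| <= 1 -> 0 <= a -> a <= b -> b <= T -> (forall t, a <= t < b -> 0 <= wy t) ->
  (wx b - c) ^+ 2 + wy b ^+ 2 <= (wx a - c) ^+ 2 + wy a ^+ 2.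
Proof.
move=> W c1 a0 ab bT y0; rewrite -lerN2.
pose f t := - ((wx t - c) ^+ 2 + wy t ^+ 2).
apply: (is_cderive_nondecreasing (f := f) (body_lip W) ab).
  by apply: continuous_within => t _; apply: cvgN; exact: (@continuous_dist2 th wx wy T c W t).
move=> t /[dup] tab /andP[at' tb].
exists (2 * wy t), (2 * c * wy t); split.
  have tT : 0 <= t < T by rewrite (le_trans a0) //= (lt_le_trans tb).
  have /is_cderive_eq := is_cderiveN (body_lip W) (is_cderive_dist2 c W tT).
  by apply; ring.
have := y0 t tab => y0t.
rewrite !normrM (ger0_norm y0t) ger0_norm //.
have := normr_ge0 c; nra.
Qed.

(* The target can only be reached from ahead: wherever |wx| < 1 the ordinate of
   the target decreases. *)
Lemma wy_pos_before th wx wy T c : body_path th wx wy T ->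
  0 < c -> c <= T -> wy c = 0 -> `|wx c| < 1 ->
  \forall e \near 0^'+, forall t, c - e < t < c -> 0 <= wy t.
Proof.
move=> W c0 cT yc xc.
have /cvgr_lt /(_ _ xc) /nbhs_ballP[d /= d0 Hd] : `|wx t| @[t --> c] --> `|wx c|.
  by apply: cvg_norm; exact: (body_cx W).
near=> e => t /andP[ct tc].
have ed : e < d by near: e; apply: nbhs_right_lt.
have ec : e < c by near: e; apply: nbhs_right_lt.
have t0 : 0 <= t by lra.
rewrite -oppr_le0; have <- : - wy c = 0 by rewrite yc oppr0.
apply: (is_cderive_nondecreasing (f := fun t => - wy t) (body_lip W) (ltW tc)).
  by apply: continuous_within => s _; apply: cvgN; exact: (body_cy W).
move=> s /andP[ts sc].
exists 1, (wx s); split.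
  have sT : 0 <= s < T by rewrite (le_trans t0) //= (lt_le_trans sc).
  by have /is_cderive_eq := is_cderiveN (body_lip W) (body_dy W sT); apply; ring.
apply: ltW; apply: Hd; rewrite /ball /= ger0_norm; lra.
Unshelve. all: by end_near. Qed.

End DiskMonotone.

(** * Lower bound for a target behind *)

Section BackBound.
Context {R : realType}.
Implicit Types (th wx wy : R -> R) (T a x y : R).

(** For a target behind, turning towards its own side is no longer than turning away from it. This
    is used when the target has changed side before coming level with the vehicle. *)
Lemma VS_flip_le x y : x <= 0 -> y < 0 -> 1 <= (- x - 1) ^+ 2 + y ^+ 2 ->
  VS (- x) y <= VS x y.
Proof.
move=> x0 y0 r1.
have le2 : (- x - 1) ^+ 2 + y ^+ 2 <= (x - 1) ^+ 2 + y ^+ 2 by nra.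
have g : tanlen (- x) y - atan (tanlen (- x) y) <= tanlen x y - atan (tanlen x y).
  by apply: tan_atan_id_le; [exact: tanlen_ge0|rewrite ler_wsqrtr // lerD2r].
have p : phir x y <= phir (- x) y.
  have yn : y != 0 by rewrite lt_eqF.
  have d1 := rr_dom_y x yn; have d2 := rr_dom_y (- x) yn.
  have rle : rr (- x) y <= rr x y by rewrite ler_wsqrtr.
  rewrite ler_wpM2l // le_atan // ler_pdivrMr // mulrAC ler_pdivlMr //.
  rewrite ler_nM2l //.
  have := rr2 x y; have := rr2 (- x) y; have := rr_ge0 x y; have := rr_ge0 (- x) y.
  move: d1 d2 rle; set r := rr x y; set r' := rr (- x) y => d1 d2 rle p1 p2 e1 e2.
  (* Each denominator times its conjugate is y^2, so it suffices to compare the conjugates r - (x -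
     1) and r' + x + 1, where r' <= r and x <= 0. *)
  have f1 : (r + (x - 1)) * (r - (x - 1)) = y ^+ 2.
    have -> : (r + (x - 1)) * (r - (x - 1)) = r ^+ 2 - (x - 1) ^+ 2 by ring.
    by rewrite e2; ring.
  have f2 : (r' + (- x - 1)) * (r' - (- x - 1)) = y ^+ 2.
    have -> : (r' + (- x - 1)) * (r' - (- x - 1)) = r' ^+ 2 - (- x - 1) ^+ 2 by ring.
    by rewrite e1; ring.
  have y2 : 0 < y ^+ 2 by rewrite exprn_even_gt0.
  have pos : 0 < r - (x - 1) by rewrite -(pmulr_rgt0 _ d1) f1.
  rewrite -(ler_pM2r pos) f1 -f2 ler_pM2l //; lra.
by rewrite /VS; lra.
Qed.

(** The difference of the two coefficients is 1: during a right turn (dth = - h) the target rotates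
    about (1, 0) at unit rate. *)
Lemma is_cderive_phir th wx wy T t : body_path th wx wy T -> 0 <= t < T ->
  0 < rr (wx t) (wy t) + (wx t - 1) -> 1 <= (wx t - 1) ^+ 2 + wy t ^+ 2 ->
  is_cderive th t (fun t => phir (wx t) (wy t))
    (- (wx t - 1) / rr (wx t) (wy t) ^+ 2)
    (- 1 - (wx t - 1) / rr (wx t) (wy t) ^+ 2).
Proof.
move=> W tT dom r1; have lth := body_lip W.
have q0 : 0 < (wx t - 1) ^+ 2 + wy t ^+ 2 by rewrite (lt_le_trans _ r1).
have dr := is_cderive_comp (g := Num.sqrt) lth (is_cderive_dist2 1 W tT)
  (is_derive1_sqrt q0).
have dd := is_cderiveD dr (is_cderiveD (body_dx W tT) (is_cderive_cst th t (- 1))).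
have du := is_cderiveM lth (body_dy W tT) (is_cderiveV lth dd (lt0r_neq0 dom)).
have := is_cderiveZ 2 lth (is_cderive_comp (g := atan) lth du (is_derive1_atan _)).
have y2 : wy t ^+ 2 = rr (wx t) (wy t) ^+ 2 - (wx t - 1) ^+ 2.
  by rewrite rr2; ring.
have r0 := rr_gt0 r1; have rn := lt0r_neq0 r0; have dn := lt0r_neq0 dom.
rewrite -/(rr (wx t) (wy t)).
move: y2 rn dn; set r := rr _ _; set X := wx t - 1; set y := wy t => y2 rn dn.
have -> : wx t = X + 1 by rewrite /X; ring.
have eu : 1 + (y * (r + X)^-1) ^+ 2 = 2 * r / (r + X).
  rewrite exprMn y2; field; exact: dn.
rewrite eu => /is_cderive_eq; apply.
- have -> : 2 * ((2 * r / (r + X))^-1 * (- 1 * (r + X)^-1 +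
    y * (- ((2 * r)^-1 * - (2 * y) + (0 + 0)) / (r + X) ^+ 2))) =
    (- r * (r + X) + y ^+ 2) / (r ^+ 2 * (r + X)).
    by field; rewrite rn dn.
  by rewrite y2; field; rewrite rn dn.
- have -> : 2 * ((2 * r / (r + X))^-1 * (- (X + 1) * (r + X)^-1 +
    y * (- ((2 * r)^-1 * - (2 * 1 * y) + (y + 0)) / (r + X) ^+ 2))) =
    (- (X + 1) * r * (r + X) + y ^+ 2 * (1 - r)) / (r ^+ 2 * (r + X)).
    by field; rewrite rn dn.
  by rewrite y2; field; rewrite rn dn.
Qed.

(* While wy <= 0, the distance to (1, 0) is nondecreasing and the angle phir grows
   at most at unit rate, hence VS decreases at most at unit rate. *)
Lemma VS_back_right_le th wx wy T a c : body_path th wx wy T ->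
  wx T = 0 -> wy T = 0 -> 0 <= a -> a < c -> c <= T ->
  (forall t, a <= t < c -> wy t < 0) -> wy c = 0 -> 0 < wx c ->
  1 <= (wx a - 1) ^+ 2 + wy a ^+ 2 -> VS (wx a) (wy a) <= T - a.
Proof.
move=> W ex ey a0 ac cT yneg yc xc r1; have lth := body_lip W.
have rmon t : a <= t <= c -> 1 <= (wx t - 1) ^+ 2 + wy t ^+ 2.
  move=> /andP[at' tc]; apply: (le_trans r1).
  apply: (dist2_nondecreasing W) => //; first by rewrite normr1.
    exact: (le_trans tc).
  move=> s /andP[as' st]; apply/ltW/yneg; rewrite as' /=.
  exact: (lt_le_trans st).
have nz : (wx c, wy c) != (0, 0) by rewrite xpair_eqE gt_eqF.
have rc : 1 <= (wx c - 1) ^+ 2 + wy c ^+ 2 by apply: rmon; rewrite lexx ltW.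
have := VS_front_le W ex ey _ (ltW xc) _ nz rc.
rewrite yc lexx (le_trans a0 (ltW ac)) cT => /(_ isT isT) front.
have dom t : a <= t <= c -> 0 < rr (wx t) (wy t) + (wx t - 1).
  move=> /andP[at']; rewrite le_eqVlt => /predU1P[->|tc].
    by apply: rr_dom => //; exact: ltW.
  by apply: rr_dom_y; rewrite lt_eqF // yneg // at' tc.
have g : tanlen (wx a) (wy a) - atan (tanlen (wx a) (wy a)) <=
    tanlen (wx c) (wy c) - atan (tanlen (wx c) (wy c)).
  apply: tan_atan_id_le; first exact: tanlen_ge0.
  rewrite ler_wsqrtr // lerD2r.
  apply: (dist2_nondecreasing W) => //; [by rewrite normr1|exact: ltW|].
  by move=> t /yneg /ltW.
pose f t := t - phir (wx t) (wy t).
have : f a <= f c.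
  apply: (is_cderive_nondecreasing lth (ltW ac)).
    apply: continuous_within => t tac; apply: cvgB; first exact: cvg_id.
    apply: cvgM; first exact: cvg_cst.
    have cx : wx s @[s --> t] --> wx t by exact: (body_cx W).
    have cy : wy s @[s --> t] --> wy t by exact: (body_cy W).
    have cX : wx s - 1 @[s --> t] --> wx t - 1 by apply: cvgB => //; exact: cvg_cst.
    apply: cvg_atan; apply: cvgM => //; apply: cvgV; first by rewrite gt_eqF // dom.
    apply: cvgD => //; apply: cvg_sqrt.
    by apply: cvgD; exact: cvg_sqr.
  move=> t /andP[at' tc].
  have tac : a <= t <= c by rewrite at' ltW.
  have tT : 0 <= t < T by rewrite (le_trans a0) //= (lt_le_trans tc).
  have dp := is_cderive_phir W tT (dom t tac) (rmon t tac).
  have df := is_cderiveD (is_cderive_id th t) (is_cderiveN lth dp).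
  (* Both coefficients coincide, so the criterion is that this number be nonnegative: r^2 + X >= 0,
     which follows from X >= - r and r >= 1. *)
  exists (1 + (wx t - 1) / rr (wx t) (wy t) ^+ 2),
         (1 + (wx t - 1) / rr (wx t) (wy t) ^+ 2); split.
    by move/is_cderive_eq : df; apply; ring.
  rewrite ger0_norm // -[X in X + _](@divff _ (rr (wx t) (wy t) ^+ 2)); last first.
    by rewrite expf_neq0 // gt_eqF // (rr_gt0 (rmon t tac)).
  rewrite -mulrDl divr_ge0 ?sqr_ge0 //.
  have := rmon t tac; have := rr2 (wx t) (wy t); have := rr_ge0 (wx t) (wy t).
  have := sqr_ge0 (wy t).
  set r := rr _ _; set X := wx t - 1; set z := wy t ^+ 2 => z0 r0 e r2.
  have r1' : 1 <= r by rewrite -(@ler_pXn2r _ 2) ?nnegrE // expr1n e.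
  have Xr : - r <= X.
    rewrite lerNl (le_trans (ler_norm _)) // normrN -(@ler_pXn2r _ 2) ?nnegrE //.
    by rewrite real_normK ?num_real // e lerDl.
  have : r * 1 <= r * r by rewrite ler_wpM2l.
  rewrite expr2; lra.
move: front g; rewrite /f /VS yc. lra.
Qed.

(** Until the first time [c] with [wy c = 0] the target recedes from both centres, so it stays
    outside both disks. There [|wx c| >= 1], since otherwise [wy] would be nonnegative just before
    [c]. The sign of [wx c] selects the turn that bounds the length, and [VS_flip_le] corrects it
    when [wx a] is on the other side. *)
Lemma VS_back_le th wx wy T a : body_path th wx wy T ->
  wx T = 0 -> wy T = 0 -> 0 <= a <= T -> wy a < 0 ->
  1 <= (wx a - 1) ^+ 2 + wy a ^+ 2 -> 1 <= (wx a + 1) ^+ 2 + wy a ^+ 2 ->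
  VS `|wx a| (wy a) <= T - a.
Proof.
move=> W ex ey /andP[a0 aT] ya r1 l1.
have [|c [ac cT yc yneg]] := first_hit aT (body_cy W) ya; first by rewrite ey.
have r1c : 1 <= (wx c - 1) ^+ 2 + wy c ^+ 2.
  apply: (le_trans r1); apply: (dist2_nondecreasing W) => //; rewrite ?normr1 ?(ltW ac) //.
  by move=> t /yneg /ltW.
have l1c : 1 <= (wx c - (-1)) ^+ 2 + wy c ^+ 2.
  have l1' : 1 <= (wx a - (-1)) ^+ 2 + wy a ^+ 2 by rewrite opprK.
  apply: (le_trans l1'); apply: (dist2_nondecreasing W) => //; rewrite ?normrN ?normr1 ?(ltW ac) //.
  by move=> t /yneg /ltW.
have c0 : 0 < c := le_lt_trans a0 ac.
have x1 : 1 <= `|wx c|.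
  rewrite leNgt; apply/negP => x1.
  have pos := wy_pos_before W c0 cT yc x1.
  near (0 : R)^'+ => e.
  have e0 : 0 < e by near: e; exact: nbhs_right_gt.
  have eac : e < c - a by near: e; apply: nbhs_right_lt; rewrite subr_gt0.
  have pos_e : forall t, c - e < t < c -> 0 <= wy t by near: e.
  have h1 : c - e < c - e / 2 < c by apply/andP; split; lra.
  have := pos_e _ h1; rewrite leNgt yneg //; lra.
have mir := body_path_mirror W.
have [xp|xn] := ltP 0 (wx c).
  have main := VS_back_right_le W ex ey a0 ac cT yneg yc xp r1.
  have [xa|xa] := leP 0 (wx a); first by rewrite ger0_norm.
  rewrite ltr0_norm //; apply: le_trans main; apply: VS_flip_le => //; first exact: ltW.
  by rewrite -opprD sqrrN.
have xn' : 0 < - wx c by move: x1; rewrite ler0_norm //; lra.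
have ex' : - wx T = 0 by rewrite ex oppr0.
have l1' : 1 <= (- wx a - 1) ^+ 2 + wy a ^+ 2 by rewrite -opprD sqrrN.
have main := VS_back_right_le mir ex' ey a0 ac cT yneg yc xn' l1'.
have [xa|xa] := leP 0 (wx a); last by rewrite ltr0_norm.
rewrite ger0_norm // -[wx a]opprK; apply: le_trans main.
by apply: VS_flip_le; rewrite ?oppr_le0 ?opprK.
Unshelve. all: by end_near. Qed.

End BackBound.

(** * Lower bound for a target inside a turning disk *)

Section DiskBound.
Context {R : realType}.
Implicit Types (th wx wy : R -> R) (T a x y : R).

(** Makes a single arctangent of the terms in [slr] of the left arc, to be compared with
    [atan (y / (x + 1))]. *)
Lemma atanB_third (k : R) : 0 <= k ->
  atan k - atan (k / 3) = atan (2 * k / (3 + k ^+ 2)).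
Proof.
move=> k0; have k3 : 0 <= k / 3 by rewrite divr_ge0.
have h1 := atan_ge0 k0; have h2 := atan_ge0 k3.
have h3 := atan_ltpi2 k; have h4 : atan (k / 3) <= atan k.
  by rewrite le_atan //; lra.
rewrite -[LHS]tanK; last by rewrite in_itv /=; apply/andP; split; lra.
congr atan; rewrite /tan sinB cosB !sin_atan !cos_atan.
have s1 := sqrt1D_gt0 k; have s2 := sqrt1D_gt0 (k / 3).
have d : 3 + k ^+ 2 != 0 by rewrite gt_eqF // ltr_wpDr // sqr_ge0.
have [n1 n2] := (lt0r_neq0 s1, lt0r_neq0 s2).
move: n1 n2; set u := Num.sqrt _; set v := Num.sqrt _ => n1 n2.
have -> : u^-1 / v + k / u * (k / 3 / v) = (3 + k ^+ 2) / (3 * u * v).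
  by field; rewrite n1 n2.
by field; rewrite n1 n2 d.
Qed.

(** On the lower half of the circle the left arc has length 0 and both paths are the same right arc.
    Here [k = - y / x] is the tangent of half of [- phir x y], and [slr x y] equals it. *)
Lemma VL_boundary x y : 0 < x -> y <= 0 -> (x - 1) ^+ 2 + y ^+ 2 = 1 ->
  VL x y = VS x y.
Proof.
move=> x0 y0 r1.
have xn := lt0r_neq0 x0.
have tl : tanlen x y = 0 by rewrite /tanlen r1 subrr sqrtr0.
have rl : rr x y = 1 by rewrite /rr r1 sqrtr1.
have y2 : y ^+ 2 = 2 * x - x ^+ 2 by lra.
pose k := - y / x.
have k0 : 0 <= k by rewrite divr_ge0 // ?oppr_ge0 // ltW.
have k2 : k ^+ 2 = (2 - x) / x by rewrite /k expr_div_n sqrrN y2; field.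
have D : dl2 x y = 4 * x + 1 by rewrite /dl2 -mulr_natl; lra.
have s : slr x y = k.
  rewrite /slr D -[RHS](ger0_norm k0) -sqrtr_sqr k2; congr Num.sqrt.
  have -> : 4 * x + 1 - 1 = 4 * x by ring.
  by field.
have ph : phir x y = - (2 * atan k).
  have -> : phir x y = 2 * atan (- k).
    by rewrite /phir rl /k addrC subrK mulNr opprK.
  by rewrite atanN mulrN.
have ch : atan (y / (x + 1)) = - (atan k - atan (k / 3)).
  rewrite atanB_third // -atanN k2; congr atan; rewrite /k; field.
  by rewrite xn gt_eqF //=; lra.
by rewrite /VL /VS tl atan0 s ph ch; ring.
Qed.

(** Along a left turn (dth = h) the length decreases at rate exactly 1. Thus [VL + t] has
    coefficients [K] and [- K], and its monotonicity amounts to [0 <= K]. *)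
Lemma is_cderive_VL th wx wy T t : body_path th wx wy T -> 0 <= t < T ->
  0 < wx t + 1 -> 1 < dl2 (wx t) (wy t) -> dl2 (wx t) (wy t) < 9 ->
  let D := dl2 (wx t) (wy t) in
  let K := 1 - (wx t + 1) / D + 3 * wy t / (slr (wx t) (wy t) * D) in
  is_cderive th t (fun t => VL (wx t) (wy t)) (K - 1) (- K).
Proof.
move=> W tT x1 D1 D9 D K; have lth := body_lip W.
have dD : is_cderive th t (fun t => dl2 (wx t) (wy t)) (- (2 * wy t)) (2 * wy t).
  have := is_cderive_dist2 (-1) W tT.
  under eq_fun do rewrite opprK.
  by move/is_cderive_eq; apply; ring.
have dn : D - 1 != 0 by rewrite gt_eqF // subr_gt0.
have dF := is_cderiveM lth
  (is_cderiveD (is_cderive_cst th t 9) (is_cderiveN lth dD))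
  (is_cderiveV lth (is_cderiveD dD (is_cderive_cst th t (-1))) dn).
have F0 : 0 < (9 - D) / (D - 1) by rewrite divr_gt0 // subr_gt0.
have ds := is_cderive_comp (g := Num.sqrt) lth dF (is_derive1_sqrt F0).
have da := is_cderive_comp (g := atan) lth ds (is_derive1_atan _).
have db := is_cderive_comp (g := atan) lth
  (is_cderiveM lth ds (is_cderive_cst th t (3^-1))) (is_derive1_atan _).
have dx1 := is_cderiveD (body_dx W tT) (is_cderive_cst th t 1).
have dc := is_cderive_comp (g := atan) lth (is_cderiveM lth (body_dy W tT)
  (is_cderiveV lth dx1 (lt0r_neq0 x1))) (is_derive1_atan _).
have := is_cderiveD (is_cderiveD dc (is_cderive_cst th t pi))
  (is_cderiveD (is_cderiveZ 3 lth da) (is_cderiveN lth db)).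
rewrite -/D -/(slr (wx t) (wy t)) -/D.
have s2 : slr (wx t) (wy t) ^+ 2 = (9 - D) / (D - 1).
  by rewrite sqr_sqrtr // ltW.
have s0 : slr (wx t) (wy t) != 0 by rewrite gt_eqF // sqrtr_gt0.
rewrite /K; move: s2 s0; set s := slr _ _ => s2 s0.
have Dn : D != 0 by rewrite gt_eqF // (lt_trans ltr01).
have xn := lt0r_neq0 x1.
have -> : (1 + s ^+ 2)^-1 = (D - 1) / 8.
  have -> : 1 + s ^+ 2 = 8 / (D - 1) by rewrite s2; field.
  by rewrite invf_div.
have -> : (1 + (s / 3) ^+ 2)^-1 = 9 * (D - 1) / (8 * D).
  have -> : 1 + (s / 3) ^+ 2 = 8 * D / (9 * (D - 1)).
    by rewrite expr_div_n s2; field.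
  by rewrite invf_div.
have -> : (1 + (wy t / (wx t + 1)) ^+ 2)^-1 = (wx t + 1) ^+ 2 / D.
  have -> : 1 + (wy t / (wx t + 1)) ^+ 2 = D / (wx t + 1) ^+ 2.
    by rewrite /D /dl2; field.
  by rewrite invf_div.
move/is_cderive_eq; apply.
- by field; rewrite dn s0 Dn xn.
- have -> : - wx t / (wx t + 1) + wy t * (- (wy t + 0) / (wx t + 1) ^+ 2) =
    (wx t + 1 - D) / (wx t + 1) ^+ 2 by rewrite /D /dl2; field.
  by field; rewrite dn s0 Dn xn.
Qed.

(* The target leaves the right disk behind the vehicle, where VL = VS; until then
   VL decreases at most at unit rate. *)
Lemma VL_disk_le th wx wy T a : body_path th wx wy T ->
  wx T = 0 -> wy T = 0 -> 0 <= a <= T ->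
  (wx a - 1) ^+ 2 + wy a ^+ 2 < 1 -> VL (wx a) (wy a) <= T - a.
Proof.
move=> W ex ey /andP[a0 aT] r1; have lth := body_lip W.
pose f t := (wx t - 1) ^+ 2 + wy t ^+ 2 - 1.
have cf : continuous f.
  move=> t; apply: cvgB; last exact: cvg_cst.
  exact: (@continuous_dist2 _ th wx wy T 1 W t).
have fa : f a < 0 by rewrite subr_lt0.
have fT : 0 <= f T by rewrite /f ex ey; lra.
have [c [ac cT fc below]] := first_hit aT cf fa fT.
have rc : (wx c - 1) ^+ 2 + wy c ^+ 2 = 1 by move: fc; rewrite /f; lra.
have inside t : a <= t < c -> (wx t - 1) ^+ 2 + wy t ^+ 2 < 1.
  by move=> /below; rewrite /f subr_lt0.
have c0 : 0 < c := le_lt_trans a0 ac.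
(* With [wy] nonnegative just before [c], the distance to the centre could not increase there and
   the target would not leave the disk. *)
have exit_low e : 0 < e -> (forall t, c - e < t < c -> 0 <= wy t) -> False.
  move=> e0 pos.
  pose s := Num.max a (c - e / 2).
  have sc : s < c by rewrite gt_max ac /=; lra.
  have as' : a <= s by rewrite le_max lexx.
  have es : c - e < s by rewrite lt_max; apply/orP; right; lra.
  have : (wx c - 1) ^+ 2 + wy c ^+ 2 <= (wx s - 1) ^+ 2 + wy s ^+ 2.
    apply: (dist2_nonincreasing W) => //; [by rewrite normr1|exact: le_trans as'|exact: ltW|].
    by move=> t /andP[st tc]; apply: pos; rewrite tc (lt_le_trans es).
  by rewrite rc leNgt inside // as' sc.
have yc : wy c <= 0.
  rewrite leNgt; apply/negP => yc.
  have /cvgr_gt /(_ _ yc) /nbhs_ballP[e /= e0 He] : wy t @[t --> c] --> wy c.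
    exact: (body_cy W).
  apply: (exit_low e e0) => t /andP[t1 t2]; apply/ltW/He.
  by rewrite /ball /= ger0_norm; lra.
(* On the circle, [wx c <= 0] happens only at the vehicle itself, which the target reaches from
   ahead; [exit_low] excludes this. *)
have xc : 0 < wx c.
  have [//|xc] := ltP 0 (wx c).
  have x0 : wx c = 0 by have := sqr_ge0 (wy c); nra.
  have y0 : wy c = 0 by apply/eqP; rewrite -sqrf_eq0; apply/eqP; move: rc; rewrite x0; lra.
  have xlt : `|wx c| < 1 by rewrite x0 normr0.
  have pos := wy_pos_before W c0 cT y0 xlt.
  near (0 : R)^'+ => e.
  have e0 : 0 < e by near: e; exact: nbhs_right_gt.
  have pos_e : forall t, c - e < t < c -> 0 <= wy t by near: e.
  by case: (exit_low e e0 pos_e).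
have rest : VL (wx c) (wy c) <= T - c.
  rewrite VL_boundary //.
  have cT' : 0 <= c <= T by rewrite ltW.
  have [yc0|yc0] := ltP (wy c) 0.
    rewrite -[wx c]ger0_norm; last exact: ltW.
    apply: (VS_back_le W) => //; first by rewrite rc.
    by have := sqr_ge0 (wy c); nra.
  apply: (VS_front_le W) => //; first exact: ltW.
    by rewrite xpair_eqE gt_eqF.
  by rewrite rc.
have xpos t : a <= t <= c -> 0 < wx t.
  move=> /andP[at']; rewrite le_eqVlt => /predU1P[->//|tc].
  have := inside t; rewrite at' tc => /(_ isT).
  by have := sqr_ge0 (wy t); nra.
have D1 t : a <= t <= c -> 1 < dl2 (wx t) (wy t).
  by move=> /xpos x0; rewrite /dl2; have := sqr_ge0 (wy t); nra.
pose g t := VL (wx t) (wy t) + t.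
suff : g a <= g c by move: rest; rewrite /g; lra.
apply: (is_cderive_nondecreasing lth (ltW ac)).
  apply: continuous_within => t tac; apply: cvgD; last exact: cvg_id.
  apply: cvg_VL; [by have := xpos t tac; lra|exact: D1| |].
    exact: (body_cx W).
  exact: (body_cy W).
move=> t /andP[at' tc].
have tac : a <= t <= c by rewrite at' ltW.
have tT : 0 <= t < T by rewrite (le_trans a0) //= (lt_le_trans tc).
have x0 := xpos t tac.
have rt := inside t; rewrite at' tc in rt; have {}rt := rt isT.
have d1 := D1 t tac.
have d9 : dl2 (wx t) (wy t) < 9 by rewrite /dl2; have := sqr_ge0 (wy t); nra.
have x1 : 0 < wx t + 1 by lra.
pose D := dl2 (wx t) (wy t).
pose K := 1 - (wx t + 1) / D + 3 * wy t / (slr (wx t) (wy t) * D).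
have dV : is_cderive th t (fun t => VL (wx t) (wy t)) (K - 1) (- K) :=
  is_cderive_VL W tT x1 d1 d9.
exists K, (- K); split.
  by have /is_cderive_eq := is_cderiveD dV (is_cderive_id th t); apply; ring.
suff K0 : 0 <= K by rewrite normrN ger0_norm.
have s2 : slr (wx t) (wy t) ^+ 2 = (9 - D) / (D - 1).
  by rewrite sqr_sqrtr // divr_ge0 // subr_ge0 ltW.
have s0 : 0 < slr (wx t) (wy t).
  by rewrite sqrtr_gt0 divr_gt0 // subr_gt0.
rewrite /K; move: s2 s0; set s := slr _ _ => s2 s0.
have D0 : 0 < D by rewrite (lt_trans ltr01).
have -> : 1 - (wx t + 1) / D + 3 * wy t / (s * D) =
  (s * (D - (wx t + 1)) + 3 * wy t) / (s * D).
  by field; rewrite !gt_eqF.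
apply: divr_ge0; last by rewrite mulr_ge0 // ltW.
have DX : 0 <= D - (wx t + 1).
  by rewrite /D /dl2; have := sqr_ge0 (wy t); nra.
have [yt|yt] := leP 0 (wy t).
  by rewrite addr_ge0 // mulr_ge0 // ltW.
rewrite -lerBlDr sub0r -mulrN.
rewrite -(@ler_pXn2r _ 2) // ?nnegrE; last 2 first.
- by rewrite mulr_ge0 // oppr_ge0 ltW.
- by rewrite mulr_ge0 // ltW.
rewrite exprMn sqrrN [leRHS]exprMn s2 [leRHS]mulrAC ler_pdivlMr ?subr_gt0 //.
have y2 : wy t ^+ 2 = D - (wx t + 1) ^+ 2 by rewrite /D /dl2; ring.
rewrite -subr_ge0 y2.
(* The first factor 4 (wx + 1) - (D + 3) equals 1 - (wx - 1)^2 - wy^2, positive inside the disk; the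
   second is positive because D > 1 and wx > 0. *)
have -> : (9 - D) * (D - (wx t + 1)) ^+ 2 - 3 ^+ 2 * (D - (wx t + 1) ^+ 2) * (D - 1) =
  D * ((4 * (wx t + 1) - (D + 3)) * (2 * (wx t + 1) - (3 - D))) by ring.
rewrite mulr_ge0 ?(ltW D0) // mulr_ge0 //; last lra.
by move: rt; rewrite /D /dl2; lra.
Unshelve. all: by end_near. Qed.

End DiskBound.

(** * Bounds on increments of integrals *)

Section IntegralIncrement.
Context {R : realType}.
Notation mu := (@lebesgue_measure R).
Implicit Types (f u : R -> R) (T rho : R).

Lemma bounded_itv_integrable f (a b c : R) :
  measurable_fun `[a, b] f -> (forall t, a <= t <= b -> `|f t| <= c) ->
  mu.-integrable `[a, b] (EFin \o f).
Proof.
move=> mf fc; apply: measurable_bounded_integrable => //.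
  by rewrite /= lebesgue_measure_itv /=; case: ifP => // _; rewrite -EFinD ltry.
exists c; split; first exact: num_real.
move=> z cz t /=; rewrite in_itv /= => tab.
by rewrite (le_trans (fc _ tab)) // ltW.
Qed.

Lemma Rintegral_increment f (a s t m M : R) :
  mu.-integrable `[a, t] (EFin \o f) -> a <= s -> s <= t ->
  (forall v, s <= v <= t -> m <= f v <= M) ->
  m * (t - s) <= \int[mu]_(v in `[a, t]) f v - \int[mu]_(v in `[a, s]) f v
    <= M * (t - s).
Proof.
move=> fi as' st fb.
rewrite Rintegral_itvB ?bnd_simp //.
have sub : [set` Interval (BRight s) (BRight t)] `<=` `[a, t].
  by apply: subset_itvr; rewrite bnd_simp.
have fi' : mu.-integrable `]s, t] (EFin \o f).
  exact: integrableS fi.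
have ci (k : R) : mu.-integrable `]s, t] (EFin \o (fun=> k)).
  have ki : mu.-integrable `[s, t] (EFin \o (fun=> k)).
    by apply: (@bounded_itv_integrable _ _ _ `|k|).
  by apply: integrableS ki => //; apply: subset_itvr; rewrite bnd_simp.
have mE : fine (mu `]s, t]) = t - s.
  rewrite lebesgue_measure_itv /= lte_fin; case: ltgtP st => //= -> _.
  by rewrite subrr.
have inst v : `]s, t]%classic v -> s <= v <= t.
  by rewrite /= in_itv /= => /andP[/ltW -> ->].
apply/andP; split.
  rewrite -mE -Rintegral_cst //.
  by apply: le_Rintegral => // v /inst /fb /andP[].
rewrite -mE -Rintegral_cst //.
by apply: le_Rintegral => // v /inst /fb /andP[].
Qed.

End IntegralIncrement.

(** * Increments of a trajectory *)

Section Trajectory.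
Context {R : realType}.
Notation mu := (@lebesgue_measure R).
Implicit Types (f u x y theta : R -> R) (T rho : R).

Lemma cos_lip (a b : R) : `|cos a - cos b| <= `|a - b|.
Proof.
wlog ab : a b / a <= b => [h|].
  by case/orP: (le_total a b) => /h // e; rewrite distrC (le_trans e) // distrC.
have [|c _ e] := MVT_segment ab (fun v _ => is_derive_cos v).
  by apply: continuous_subspaceT => v; exact: continuous_cos.
rewrite distrC e normrM normrN distrC ler_piMl // ler_norml sin_geN1 sin_le1 //.
Qed.

Lemma sin_lip (a b : R) : `|sin a - sin b| <= `|a - b|.
Proof.
have := cos_lip (a - pi / 2) (b - pi / 2).
by rewrite !cosBpihalf opprB addrA subrK.
Qed.

Lemma within_continuous_lip (f : R -> R) rho T : 0 < rho ->
  (forall s t, 0 <= s -> s <= t -> t <= T -> `|f t - f s| <= (t - s) / rho) ->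
  {within `[0, T], continuous f}.
Proof.
move=> r0 lf; apply/subspace_continuousP => s /=.
rewrite in_itv /= => /andP[s0 sT].
apply/cvgrPdist_le => e e0.
have er : 0 < e * rho by rewrite mulr_gt0.
have ner : \forall v \near s, `|s - v| <= e * rho.
  by apply/nbhs_ballP; exists (e * rho) => // v /ltW.
near=> v.
have : `[0, T]%classic v by near: v; apply: withinT.
rewrite /= in_itv /= => /andP[v0 vT].
have sv : `|s - v| <= e * rho by near: v; apply: cvg_within.
have [sv'|vs'] := leP s v.
  rewrite distrC (le_trans (lf _ _ s0 sv' vT)) // ler_pdivrMr //.
  by rewrite (le_trans _ sv) // distrC ler_norm.
rewrite (le_trans (lf _ _ v0 (ltW vs') sT)) // ler_pdivrMr //.
by rewrite (le_trans _ sv) // ler_norm.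
Unshelve. all: by end_near. Qed.

(** Over a time t - s the heading moves by at most (t - s) / rho, hence so do its sine and cosine;
    integrating this deviation gives the quadratic error. *)
Lemma trajectory_increments rho T u x y theta : 0 < rho ->
  admissible_control T u -> dubins_trajectory rho T u x y theta ->
  forall s t, 0 <= s -> s <= t -> t <= T ->
  [/\ `|theta t - theta s| <= (t - s) / rho,
      `|x t - x s - (t - s) * cos (theta s)| <= (t - s) ^+ 2 / rho &
      `|y t - y s - (t - s) * sin (theta s)| <= (t - s) ^+ 2 / rho].
Proof.
move=> r0 [mu_ bu] tr.
have ir : 0 < rho^-1 by rewrite invr_gt0.
have ui t : 0 <= t -> t <= T -> mu.-integrable `[0, t] (EFin \o (fun s => u s / rho)).
  move=> t0 tT; apply: (@bounded_itv_integrable _ _ _ _ (rho^-1)).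
    apply: measurable_funM; last exact: measurable_cst.
    by apply: measurable_funS mu_ => //; apply: subset_itvl; rewrite bnd_simp.
  move=> s /andP[s0 st]; rewrite normrM (gtr0_norm ir) ler_piMl // ?(ltW ir) //.
  by rewrite ler_norml bu // s0 (le_trans st).
have hth s t : 0 <= s -> s <= t -> t <= T -> `|theta t - theta s| <= (t - s) / rho.
  move=> s0 st tT.
  have [_ _ ->] := tr t (introT andP (conj (le_trans s0 st) tT)).
  have [_ _ ->] := tr s (introT andP (conj s0 (le_trans st tT))).
  rewrite opprD addrACA subrr add0r.
  have := @Rintegral_increment R (fun s => u s / rho) 0 s t (- rho^-1) (rho^-1).
  rewrite mulNr -ler_norml mulrC; apply => //; first exact: ui (le_trans s0 st) tT.
  move=> v /andP[sv vt].
  have /andP[u1 u2] := bu v (introT andP (conj (le_trans s0 sv) (le_trans vt tT))).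
  by rewrite -mulN1r ler_pM2r // u1 /= -[leRHS]mul1r ler_pM2r.
have cth t : 0 <= t <= T -> {within `[0, t], continuous theta}.
  move=> /andP[t0 tT]; apply: (within_continuous_lip r0) => s v s0 sv vt.
  exact: hth (le_trans vt tT).
have trig (f F : R -> R) s t : continuous f -> (forall a b, `|f a - f b| <= `|a - b|) ->
    (forall t, 0 <= t <= T -> F t = \int[mu]_(s in `[0, t]) f (theta s)) ->
    0 <= s -> s <= t -> t <= T ->
    `|F t - F s - (t - s) * f (theta s)| <= (t - s) ^+ 2 / rho.
  move=> cf fl FE s0 st tT; have t0 := le_trans s0 st.
  have sT := le_trans st tT.
  rewrite !FE ?t0 ?s0 //.
  have fi : mu.-integrable `[0, t] (EFin \o (fun s => f (theta s))).
    apply: continuous_compact_integrable; first exact: segment_compact.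
    move=> v; apply: continuous_comp; last exact: cf.
    by apply: cth; rewrite t0.
  have := @Rintegral_increment R (fun s => f (theta s)) 0 s t
    (f (theta s) - (t - s) / rho) (f (theta s) + (t - s) / rho) fi s0 st.
  move=> H; have {}H := H _.
  have /H /andP[h1 h2] : forall v, s <= v <= t ->
      f (theta s) - (t - s) / rho <= f (theta v) <= f (theta s) + (t - s) / rho.
    move=> v /andP[sv vt]; rewrite -ler_distl.
    apply: (le_trans (fl _ _)); apply: (le_trans (hth _ _ s0 sv (le_trans vt tT))).
    by rewrite ler_pM2r // lerD2r.
  have e : (t - s) ^+ 2 / rho = (t - s) / rho * (t - s) by ring.
  rewrite ler_norml e; move: h1 h2; set I1 := Rintegral _ _ _; set I2 := Rintegral _ _ _.
  by move=> h1 h2; apply/andP; split; lra.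
move=> s t s0 st tT; split; first exact: hth.
- apply: trig => //; first exact: continuous_cos.
    exact: cos_lip.
  by move=> v vT; have [] := tr v vT.
- apply: trig => //; first exact: continuous_sin.
    exact: sin_lip.
  by move=> v vT; have [] := tr v vT.
Qed.

End Trajectory.

(** * From trajectories to motions in the frame of the vehicle *)

Section ReachesBodyPath.
Context {R : realType}.
Implicit Types (x y theta : R -> R) (T rho : R).

Lemma cvg_lip (f : R -> R) (C : R) : (forall s t, `|f s - f t| <= C * `|s - t|) ->
  continuous f.
Proof.
move=> lf t.
have C0 : 0 <= C.
  have := lf 1 0; rewrite subr0 normr1 mulr1; exact: le_trans.
apply/cvgrPdist_le => e e0.
have C1 : 0 < C + 1 by rewrite ltr_wpDl.
apply/nbhs_ballP; exists (e / (C + 1)); first exact: divr_gt0.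
move=> s; rewrite /ball /= ltr_pdivlMr // => st.
apply: (le_trans (lf _ _)); apply: le_trans (ltW st).
by rewrite mulrC ler_wpM2l // lerDl.
Qed.

Lemma reaches_body_path rho T (p : R * R) : 0 < rho -> 0 <= T ->
  reaches rho T p ->
  exists th wx wy : R -> R, [/\ body_path th wx wy (T / rho),
    wx 0 = p.1 / rho, wy 0 = p.2 / rho, wx (T / rho) = 0 & wy (T / rho) = 0].
Proof.
move=> r0 T0 [u [x [y [theta [adm tr px]]]]].
have inc := trajectory_increments r0 adm tr.
have rn := lt0r_neq0 r0.
(* Time is rescaled to turning radius 1 and clamped to [0, T]: the trajectory is specified only
   there, whereas [body_path] asks for a heading and coordinates that are regular on the whole
   line. *)
pose c s := Num.max 0 (Num.min T (rho * s)).
have c0 s : 0 <= c s by rewrite le_max lexx.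
have cT s : c s <= T by rewrite ge_max T0 ge_min lexx.
have cE s : 0 <= s <= T / rho -> c s = rho * s.
  move=> /andP[s0 sT].
  have sT' : rho * s <= T by rewrite mulrC -ler_pdivlMr.
  by rewrite /c min_r // max_r // mulr_ge0 // ltW.
have cle s t : s <= t -> c s <= c t.
  move=> st; have : rho * s <= rho * t by rewrite ler_pM2l.
  rewrite /c => h; case: (lerP T (rho * s)); case: (lerP T (rho * t)) => h1 h2;
  case: (lerP 0 T); case: (lerP 0 (rho * t)); case: (lerP 0 (rho * s)) => *; lra.
have clip s t : s <= t -> c t - c s <= rho * (t - s).
  move=> st; have : rho * s <= rho * t by rewrite ler_pM2l.
  rewrite /c => h; case: (lerP T (rho * s)); case: (lerP T (rho * t)) => h1 h2;
  case: (lerP 0 T); case: (lerP 0 (rho * t)); case: (lerP 0 (rho * s)) => *; lra.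
have lip_of (f : R -> R) (C : R) : 0 <= C ->
    (forall s t, 0 <= s -> s <= t -> t <= T -> `|f t - f s| <= C * (t - s)) ->
    forall s t, `|f (c s) - f (c t)| <= C * rho * `|s - t|.
  move=> C0 lf s t; wlog st : s t / s <= t => [h|].
    case/orP: (le_total s t) => /h // e.
    by rewrite distrC (le_trans e) // distrC.
  rewrite distrC (le_trans (lf _ _ _ _ _)) // ?cle // -mulrA ler_wpM2l //.
  by rewrite distrC ger0_norm ?subr_ge0 // clip.
pose th s := theta (c s); pose X s := x (c s) / rho; pose Y s := y (c s) / rho.
have lth : lip1 th.
  have i0 : 0 <= rho^-1 by rewrite invr_ge0 ltW.
  move=> s t; rewrite -[leRHS]mul1r -(mulVf rn); apply: (lip_of theta _ i0).
  by move=> s' t' s0 st tT; rewrite mulrC; have [] := inc _ _ s0 st tT.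
have cth : continuous th.
  by apply: (@cvg_lip _ 1) => s t; rewrite mul1r; exact: lth.
have lipz (f : R -> R) (g : R -> R) : (forall a, `|g a| <= 1) ->
    (forall s t, 0 <= s -> s <= t -> t <= T ->
      `|f t - f s - (t - s) * g (theta s)| <= (t - s) ^+ 2 / rho) ->
    continuous (fun s => f (c s) / rho).
  move=> g1 fi.
  (* Slope bound: the unit speed contributes 1, and the quadratic error (t - s)^2 / rho is at most
     (T / rho) (t - s). *)
  have C0 : 0 <= 1 + T / rho by rewrite addr_ge0 // divr_ge0 // ltW.
  have := lip_of f (1 + T / rho) C0.
  move=> H; have {}H := H _.
  have /H lf : forall s t, 0 <= s -> s <= t -> t <= T ->
      `|f t - f s| <= (1 + T / rho) * (t - s).
    move=> s t s0 st tT.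
    have -> : f t - f s = (f t - f s - (t - s) * g (theta s)) + (t - s) * g (theta s).
      by ring.
    have ts : 0 <= t - s by rewrite subr_ge0.
    rewrite (le_trans (ler_normD _ _)) // [leRHS]mulrDl mul1r [leRHS]addrC lerD //; last first.
      by rewrite normrM ger0_norm // ler_piMr.
    rewrite (le_trans (fi _ _ s0 st tT)) // expr2 mulrAC ler_wpM2r //.
    by rewrite ler_wpM2r ?invr_ge0 ?(ltW r0) //; lra.
  move=> s; apply: cvgM; last exact: cvg_cst.
  exact: (@cvg_lip (fun s => f (c s)) _ lf).
have dz (f : R -> R) (g : R -> R) : 
    (forall s t, 0 <= s -> s <= t -> t <= T ->
      `|f t - f s - (t - s) * g (theta s)| <= (t - s) ^+ 2 / rho) ->
    forall t, 0 <= t < T / rho -> is_cderive th t (fun s => f (c s) / rho) (g (th t)) 0.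
  move=> fi t /andP[t0 tT] e e0; near=> h.
  have h0 : 0 < h by near: h; exact: nbhs_right_gt.
  have he : h <= e by near: h; exact: nbhs_right_le.
  have thT : t + h <= T / rho.
    rewrite -lerBrDl; near: h; apply: nbhs_right_le; by rewrite subr_gt0.
  have th0 : 0 <= t + h by rewrite addr_ge0 // ltW.
  have e1 : c t = rho * t by rewrite cE // t0 ltW.
  have e2 : c (t + h) = rho * (t + h) by rewrite cE // th0.
  have := fi (c t) (c (t + h)) (c0 _) (cle _ _ _) (cT _).
  rewrite lerDl (ltW h0) => /(_ isT).
  rewrite mul0r subr0 /th.
  have -> : c (t + h) - c t = rho * h by rewrite e1 e2; ring.
  move: (f (c (t + h))) (f (c t)) (g (theta (c t))) => f1 f2 g1 H.
  have -> : f1 / rho - f2 / rho - g1 * h = (f1 - f2 - rho * h * g1) / rho by field.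
  rewrite normrM [`|rho^-1|]gtr0_norm ?invr_gt0 // ler_pdivrMr //.
  apply: (le_trans H).
  have -> : (rho * h) ^+ 2 / rho = h * (h * rho) by field.
  by rewrite -mulrA ler_wpM2r // mulr_ge0 // ltW.
have cX : continuous X.
  apply: (lipz x cos) => [a|s t s0 st tT]; first by rewrite ler_norml cos_geN1 cos_le1.
  by have [] := inc _ _ s0 st tT.
have cY : continuous Y.
  apply: (lipz y sin) => [a|s t s0 st tT]; first by rewrite ler_norml sin_geN1 sin_le1.
  by have [] := inc _ _ s0 st tT.
have dX t : 0 <= t < T / rho -> is_cderive th t X (cos (th t)) 0.
  by apply: dz => s v s0 sv vT; have [] := inc _ _ s0 sv vT.
have dY t : 0 <= t < T / rho -> is_cderive th t Y (sin (th t)) 0.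
  by apply: dz => s v s0 sv vT; have [] := inc _ _ s0 sv vT.
have cc : continuous (fun s => cos (th s)).
  by move=> s; apply: continuous_comp; [exact: cth|exact: continuous_cos].
have cs : continuous (fun s => sin (th s)).
  by move=> s; apply: continuous_comp; [exact: cth|exact: continuous_sin].
(* Components of the vector from the vehicle to the target, in units of [rho], along the right
   normal (sin th, - cos th) and the heading (cos th, sin th). *)
pose wx s := (p.1 / rho - X s) * sin (th s) - (p.2 / rho - Y s) * cos (th s).
pose wy s := (p.1 / rho - X s) * cos (th s) + (p.2 / rho - Y s) * sin (th s).
have cpX : continuous (fun s => p.1 / rho - X s).
  by move=> s; apply: cvgB; [exact: cvg_cst|exact: cX].
have cpY : continuous (fun s => p.2 / rho - Y s).
  by move=> s; apply: cvgB; [exact: cvg_cst|exact: cY].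
have dpX t : 0 <= t < T / rho ->
    is_cderive th t (fun s => p.1 / rho - X s) (- cos (th t)) 0.
  move=> tT; have /is_cderive_eq := is_cderiveD (is_cderive_cst th t (p.1 / rho))
    (is_cderiveN lth (dX t tT)).
  by apply; ring.
have dpY t : 0 <= t < T / rho ->
    is_cderive th t (fun s => p.2 / rho - Y s) (- sin (th t)) 0.
  move=> tT; have /is_cderive_eq := is_cderiveD (is_cderive_cst th t (p.2 / rho))
    (is_cderiveN lth (dY t tT)).
  by apply; ring.
have dcos t := is_cderive_comp (g := cos) lth (is_cderive_th th t) (is_derive_cos _).
have dsin t := is_cderive_comp (g := sin) lth (is_cderive_th th t) (is_derive_sin _).
have Tr0 : 0 <= T / rho by rewrite divr_ge0 // ltW.
have cz : c 0 = 0 by rewrite cE ?mulr0 // lexx.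
have cend : c (T / rho) = T by rewrite cE ?lexx ?andbT //; field.
have [x00 y00 th00] : [/\ x 0 = 0, y 0 = 0 & theta 0 = pi / 2].
  have [-> -> ->] := tr 0 (introT andP (conj (lexx 0) T0)).
  by rewrite !set_itv1 !Rintegral_set1 addr0.
have [xT yT] : x T = p.1 /\ y T = p.2 by rewrite -px.
exists th, wx, wy; split.
- split => //.
  + move=> s; apply: cvgB; apply: cvgM; [exact: cpX|exact: cs|exact: cpY|exact: cc].
  + move=> s; apply: cvgD; apply: cvgM; [exact: cpX|exact: cc|exact: cpY|exact: cs].
  + move=> t tT; have /is_cderive_eq := is_cderiveD
      (is_cderiveM lth (dpX t tT) (dsin t))
      (is_cderiveN lth (is_cderiveM lth (dpY t tT) (dcos t))).
    by apply; rewrite /wy; ring.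
  + move=> t tT; have /is_cderive_eq := is_cderiveD
      (is_cderiveM lth (dpX t tT) (dcos t))
      (is_cderiveM lth (dpY t tT) (dsin t)).
    apply; last by rewrite /wx; ring.
    by rewrite -(cos2Dsin2 (th t)); ring.
- by rewrite /wx /X /Y /th cz x00 y00 th00 sin_pihalf cos_pihalf; ring.
- by rewrite /wy /X /Y /th cz x00 y00 th00 sin_pihalf cos_pihalf; ring.
- by rewrite /wx /X /Y cend xT yT; ring.
- by rewrite /wy /X /Y cend xT yT; ring.
Unshelve. all: by end_near. Qed.

End ReachesBodyPath.

(** * Concatenation of trajectories *)

Section Concatenation.
Context {R : realType}.
Notation mu := (@lebesgue_measure R).
Implicit Types (f g : R -> R) (T rho k a : R).

Lemma Rintegral_is_derive (f F : R -> R) (a b : R) : a <= b -> continuous f ->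
  (forall s : R, is_derive s 1 F (f s)) ->
  \int[mu]_(s in `[a, b]) f s = F b - F a.
Proof.
move=> ab cf dF; move: ab; rewrite le_eqVlt => /predU1P[<-|ab].
  by rewrite set_itv1 Rintegral_set1 subrr.
have cF : continuous F.
  by move=> s; apply/differentiable_continuous/derivable1_diffP; case: (dF s).
rewrite /Rintegral (continuous_FTC2 (F := F) ab) //.
- exact: continuous_subspaceT.
- split => //.
  + by apply: cvg_at_right_filter; exact: cF.
  + by apply: cvg_at_left_filter; exact: cF.
- by move=> s _; rewrite derive1E; case: (dF s).
Qed.

Lemma glue_measurable f g (T b : R) : 0 <= T -> T <= b ->
  measurable_fun `[0, T] f -> measurable_fun setT g ->
  measurable_fun `[0, b] (fun s => if s <= T then f s else g s).
Proof.
move=> T0 Tb mf mg.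
have -> : `[0, b]%classic = `[0, T] `|` `]T, b].
  by rewrite -itv_bndbnd_setU // bnd_simp.
apply/measurable_funU => //; split.
- apply: eq_measurable_fun mf => s; rewrite inE /= in_itv /= => /andP[_ sT].
  by rewrite sT.
- apply: (@eq_measurable_fun _ _ _ _ _ g); last exact: measurable_funTS.
  by move=> s; rewrite inE /= in_itv /= => /andP[Ts _]; rewrite leNgt Ts.
Qed.

Lemma Rintegral_glue f g F (T t c : R) : 0 <= T ->
  measurable_fun `[0, T] f -> (forall s, 0 <= s <= T -> `|f s| <= c) ->
  continuous g -> (forall s, `|g s| <= c) -> (forall s : R, is_derive s 1 F (g s)) ->
  0 <= t ->
  \int[mu]_(s in `[0, t]) (if s <= T then f s else g s) =
  if t <= T then \int[mu]_(s in `[0, t]) f s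
  else \int[mu]_(s in `[0, T]) f s + (F t - F T).
Proof.
move=> T0 mf fc cg gc dF t0; case: ifP => [tT|/negbT].
  apply: eq_Rintegral => s; rewrite inE /= in_itv /= => /andP[_ st].
  by rewrite (le_trans st).
rewrite -ltNge => Tt.
have mg : measurable_fun setT g by exact: continuous_measurable_fun.
have gi : mu.-integrable `[0, t] (EFin \o (fun s => if s <= T then f s else g s)).
  apply: (@bounded_itv_integrable _ _ _ _ c); first exact: glue_measurable (ltW Tt) mf mg.
  move=> s /andP[s0 st]; case: ifP => // sT; by rewrite fc // s0.
have := @Rintegral_itvB R (fun s => if s <= T then f s else g s) (BLeft 0) (BRight t) T gi.
rewrite !bnd_simp => /(_ T0 (ltW Tt)) e.
rewrite -(Rintegral_is_derive (ltW Tt) cg dF).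
rewrite -[LHS](subrK (\int[mu]_(s in `[0, T]) (if s <= T then f s else g s))) e addrC.
congr (_ + _).
  by apply: eq_Rintegral => s; rewrite inE /= in_itv /= => /andP[_ ->].
have gi2 : mu.-integrable `]T, t] (EFin \o g).
  apply: integrableS (@bounded_itv_integrable _ g T t c _ _) => //.
    by apply: subset_itvr; rewrite bnd_simp.
  exact: measurable_funTS.
rewrite -Rintegral_itv_obnd_cbnd //.
apply: eq_Rintegral => s; rewrite inE /= in_itv /= => /andP[Ts _].
by rewrite leNgt Ts.
Qed.

(** The final heading, as a real lift, is recorded in addition to the position: a continuation must
    start from it. *)
Definition reaches_state rho T (x1 y1 th1 : R) :=
  exists u x y theta, [/\ admissible_control T u,
    dubins_trajectory rho T u x y theta & [/\ x T = x1, y T = y1 & theta T = th1]].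

Lemma reaches_state_reaches rho T x1 y1 th1 :
  reaches_state rho T x1 y1 th1 -> reaches rho T (x1, y1).
Proof.
by move=> [u [x [y [theta [adm tr [xT yT _]]]]]]; exists u, x, y, theta; rewrite xT yT.
Qed.

Lemma reaches_state0 rho : reaches_state rho 0 0 0 (pi / 2).
Proof.
exists (fun=> 0), (fun=> 0), (fun=> 0), (fun=> pi / 2); split => //.
  split; first exact: measurable_cst.
  by move=> t _; rewrite lerN10 ler01.
move=> t; rewrite -eq_le => /eqP <-.
by rewrite !set_itv1 !Rintegral_set1 addr0.
Qed.

(** Covers arcs (k = 1 or -1) and segments (k = 0) together: the primitives [F] and [G] of the
    velocity under constant control are supplied by each use. *)
Lemma reaches_state_extend rho T x1 y1 th1 k a F G : 0 < rho -> 0 <= T -> 0 <= a ->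
  -1 <= k <= 1 ->
  (forall s : R, is_derive s 1 F (cos (th1 + k / rho * (s - T)))) ->
  (forall s : R, is_derive s 1 G (sin (th1 + k / rho * (s - T)))) ->
  reaches_state rho T x1 y1 th1 ->
  reaches_state rho (T + a) (x1 + (F (T + a) - F T)) (y1 + (G (T + a) - G T))
    (th1 + k / rho * a).
Proof.
move=> r0 T0 a0 k1 dF dG [u [x [y [theta [[mu_ bu] tr [xT yT thT]]]]]].
have Ta : T <= T + a by rewrite lerDl.
pose th2 s := th1 + k / rho * (s - T).
pose glue (f g : R -> R) s := if s <= T then f s else g s.
exists (glue u (fun=> k)), (glue x (fun s => x1 + (F s - F T))),
  (glue y (fun s => y1 + (G s - G T))), (glue theta th2).
have cth2 : continuous th2.
  move=> s; apply: cvgD; first exact: cvg_cst.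
  by apply: cvgM; [exact: cvg_cst|apply: cvgB => //; exact: cvg_cst].
have TT : 0 <= T <= T by rewrite T0 lexx.
(* At [T] the glued function takes its first branch, so for a = 0 the two branches must agree
   there. *)
have glueT (f g : R -> R) : f T = g T -> glue f g (T + a) = g (T + a).
  move=> e; rewrite /glue; case: ifP => // h.
  have -> : T + a = T by apply/eqP; rewrite eq_le h Ta.
  exact: e.
have adm : admissible_control T u by [].
have mth : measurable_fun `[0, T] theta.
  have inc := trajectory_increments r0 adm tr.
  apply: subspace_continuous_measurable_fun => //.
  apply: (within_continuous_lip r0) => s t s0 st tT.
  by have [] := inc _ _ s0 st tT.
split.
- split.
    by apply: glue_measurable => //; exact: measurable_cst.
  move=> t /andP[t0 tT]; rewrite /glue; case: ifP => // ht.
  by apply: bu; rewrite t0.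
- have trig (f : R -> R) (z : R -> R) z1 H : continuous f -> (forall v, `|f v| <= 1) ->
      z T = z1 ->
      (forall t, 0 <= t <= T -> z t = \int[mu]_(s in `[0, t]) f (theta s)) ->
      (forall s : R, is_derive s 1 H (f (th2 s))) ->
      forall t, 0 <= t -> glue z (fun s => z1 + (H s - H T)) t =
        \int[mu]_(s in `[0, t]) f (glue theta th2 s).
    move=> cf f1 zT zE dH t t0.
    have -> : (fun s => f (glue theta th2 s)) =
        (fun s => if s <= T then f (theta s) else f (th2 s)).
      by apply/funext => s; rewrite /glue; case: ifP.
    rewrite (@Rintegral_glue _ _ H T t 1) //.
    + rewrite /glue; case: ifP => [tT|_]; first by rewrite zE // t0.
      by rewrite -zT zE.
    + apply: measurableT_comp => //; exact: continuous_measurable_fun.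
    + by move=> s; apply: continuous_comp; [exact: cth2|exact: cf].
  move=> t /andP[t0 tT]; split.
  + apply: trig => //; first exact: continuous_cos.
      by move=> v; rewrite ler_norml cos_geN1 cos_le1.
    by move=> v vT; have [] := tr v vT.
  + apply: trig => //; first exact: continuous_sin.
      by move=> v; rewrite ler_norml sin_geN1 sin_le1.
    by move=> v vT; have [] := tr v vT.
  + have -> : (fun s => glue u (fun=> k) s / rho) =
        (fun s => if s <= T then u s / rho else k / rho).
      by apply/funext => s; rewrite /glue; case: ifP.
    have dk (s : R) : is_derive s 1 (fun s : R => k / rho * s) (k / rho).
      by apply: is_derive_eq; rewrite /GRing.scale /= mulr1.
    rewrite (@Rintegral_glue (fun s => u s / rho) (fun=> k / rho)
      (fun s => k / rho * s) T t (rho^-1)) //.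
    * rewrite /glue; case: ifP => [tT'|_].
        by have [|_ _ ->] := tr t; rewrite ?t0.
      have [_ _ e] := tr T TT; rewrite /th2 -thT e -addrA -mulrBr.
      by [].
    * apply: measurable_funM => //; exact: measurable_cst.
    * move=> s sT; rewrite normrM [`|rho^-1|]gtr0_norm ?invr_gt0 //.
      by rewrite ler_piMl ?invr_ge0 ?(ltW r0) // ler_norml bu.
    * by move=> s; exact: cvg_cst.
    * move=> s; rewrite normrM [`|rho^-1|]gtr0_norm ?invr_gt0 //.
      by rewrite ler_piMl ?invr_ge0 ?(ltW r0) // ler_norml.
- split.
  + by rewrite glueT // subrr addr0.
  + by rewrite glueT // subrr addr0.
  + rewrite glueT; first by rewrite /th2 [T + a]addrC addrK.
    by rewrite /th2 subrr mulr0 addr0.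
Qed.

End Concatenation.

(** * Realisation of the explicit paths *)

Section Paths.
Context {R : realType}.
Variable rho : R.
Hypothesis rho_gt0 : 0 < rho.
Implicit Types (T a k x y th : R).

(* Lengths, times and positions are measured in units of rho. *)
Definition unit_state T x y th :=
  0 <= T /\ reaches_state rho (rho * T) (rho * x) (rho * y) th.

Lemma unit_state_start : unit_state 0 0 0 (pi / 2).
Proof. by split => //; rewrite mulr0; exact: reaches_state0. Qed.

Lemma unit_state_straight T x y th a : 0 <= a -> unit_state T x y th ->
  unit_state (T + a) (x + a * cos th) (y + a * sin th) th.
Proof.
move=> a0 [T0 st]; split; first exact: addr_ge0.
have dl (c : R) (s : R) : is_derive s 1 (fun s : R => c * s) c.
  by apply: is_derive_eq; rewrite /GRing.scale /= mulr1.
have rT : 0 <= rho * T by rewrite mulr_ge0 // ltW.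
have ra : 0 <= rho * a by rewrite mulr_ge0 // ltW.
have k0 : -1 <= (0 : R) <= 1 by rewrite lerN10 ler01.
have dF (s : R) : is_derive s 1 (fun s : R => cos th * s)
   (cos (th + 0 / rho * (s - rho * T))) by rewrite !mul0r addr0.
have dG (s : R) : is_derive s 1 (fun s : R => sin th * s)
   (sin (th + 0 / rho * (s - rho * T))) by rewrite !mul0r addr0.
have := reaches_state_extend rho_gt0 rT ra k0 dF dG st.
rewrite !mul0r addr0 -mulrDr; congr reaches_state; ring.
Qed.

Lemma unit_state_turn T x y th k a : 0 <= a -> k ^+ 2 = 1 ->
  unit_state T x y th ->
  unit_state (T + a) (x + k * (sin (th + k * a) - sin th))
    (y - k * (cos (th + k * a) - cos th)) (th + k * a).
Proof.
move=> a0 k2 [T0 st]; split; first exact: addr_ge0.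
have rn := lt0r_neq0 rho_gt0.
have rT : 0 <= rho * T by rewrite mulr_ge0 // ltW.
have ra : 0 <= rho * a by rewrite mulr_ge0 // ltW.
have k1 : -1 <= k <= 1 by rewrite -ler_norml -(@expr_le1 _ 2) // real_normK ?num_real // k2.
have dang (s : R) : is_derive s 1 (fun s : R => th + k / rho * (s - rho * T)) (k / rho).
  by apply: is_derive_eq; rewrite /GRing.scale /=; ring.
pose F s := rho * k * sin (th + k / rho * (s - rho * T)).
pose G s := - (rho * k) * cos (th + k / rho * (s - rho * T)).
have kk : rho * k * (k / rho) = 1 by rewrite -[RHS]k2; field.
have dF (s : R) : is_derive s 1 F (cos (th + k / rho * (s - rho * T))).
  have d := @is_derive1_comp R sin (fun s => th + k / rho * (s - rho * T)) s _ _
    (is_derive_sin _) (dang s).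
  apply: (is_derive_eq (is_deriveZ (rho * k) d)).
  by rewrite /GRing.scale /= mulrCA kk mulr1.
have dG (s : R) : is_derive s 1 G (sin (th + k / rho * (s - rho * T))).
  have d := @is_derive1_comp R cos (fun s => th + k / rho * (s - rho * T)) s _ _
    (is_derive_cos _) (dang s).
  apply: (is_derive_eq (is_deriveZ (- (rho * k)) d)).
  by rewrite /GRing.scale /= -[RHS]mulr1 -[in RHS]kk; ring.
have := reaches_state_extend rho_gt0 rT ra k1 dF dG st.
have e : th + k / rho * (rho * a) = th + k * a by field.
rewrite /F /G [rho * T + rho * a - rho * T]addrC addKr subrr mulr0 addr0 e -mulrDr.
congr reaches_state; ring.
Qed.

Lemma unit_state_reaches T x y th : unit_state T x y th ->
  reaches rho (rho * T) (rho * x, rho * y).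
Proof. by case=> _; exact: reaches_state_reaches. Qed.

(* For k = -1 this is the reflection of a state in the initial axis. *)
Definition mirror_state k T x y th :=
  unit_state T (k * x) y (pi / 2 + k * (th - pi / 2)).

Section Mirror.
Variable k : R.
Hypothesis k2 : k ^+ 2 = 1.

Lemma sqr1E : k = 1 \/ k = -1.
Proof.
have : (k == 1) || (k == -1) by rewrite -sqrf_eq1 k2.
by case/orP => /eqP; [left|right].
Qed.

Lemma mirror_sin th : sin (pi / 2 + k * (th - pi / 2)) = sin th.
Proof.
have [->|->] := sqr1E; first by rewrite mul1r addrC subrK.
have -> : pi / 2 + - 1 * (th - pi / 2) = - th + pi by field.
by rewrite sinDpi sinN opprK.
Qed.

Lemma mirror_cos th : cos (pi / 2 + k * (th - pi / 2)) = k * cos th.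
Proof.
have [->|->] := sqr1E; first by rewrite !mul1r addrC subrK.
have -> : pi / 2 + - 1 * (th - pi / 2) = - th + pi by field.
by rewrite cosDpi cosN mulN1r.
Qed.

Lemma mirror_state_start : mirror_state k 0 0 0 (pi / 2).
Proof. by rewrite /mirror_state subrr !mulr0 addr0; exact: unit_state_start. Qed.

Lemma mirror_state_straight T x y th a : 0 <= a -> mirror_state k T x y th ->
  mirror_state k (T + a) (x + a * cos th) (y + a * sin th) th.
Proof.
move=> a0 /(unit_state_straight a0); rewrite mirror_sin mirror_cos.
by congr unit_state; ring.
Qed.

Lemma mirror_state_turn T x y th j a : 0 <= a -> j ^+ 2 = 1 ->
  mirror_state k T x y th ->
  mirror_state k (T + a) (x + j * (sin (th + j * a) - sin th))
    (y - j * (cos (th + j * a) - cos th)) (th + j * a).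
Proof.
move=> a0 j2; have kj : (k * j) ^+ 2 = 1 by rewrite exprMn k2 j2 mulr1.
move=> /(unit_state_turn a0 kj).
have -> : pi / 2 + k * (th - pi / 2) + k * j * a =
  pi / 2 + k * (th + j * a - pi / 2) by ring.
rewrite !mirror_sin !mirror_cos; congr unit_state; first ring.
by rewrite -mulrBr mulrA [k * j * k]mulrAC -expr2 k2 mul1r.
Qed.

Lemma mirror_state_reaches T x y th : mirror_state k T x y th ->
  reaches rho (rho * T) (rho * (k * x), rho * y).
Proof. exact: unit_state_reaches. Qed.

(** [j] is the side of the turn, 1 for left and -1 for right, and [x] is the lateral coordinate of
    the target counted towards that side. *)
Lemma reaches_turn_straight T z1 z2 th j x y : mirror_state k T z1 z2 th ->
  j ^+ 2 = 1 -> 0 <= x -> (x, y) != (0, 0) -> 1 <= (x - 1) ^+ 2 + y ^+ 2 ->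
  reaches rho (rho * (T + VS x y))
    (rho * (k * (z1 - j * x * sin th + y * cos th)),
     rho * (z2 + j * x * cos th + y * sin th)).
Proof.
move=> st j2 x0 n0 r1; have dom := rr_dom x0 r1 n0.
have al0 := arcS_ge0 r1 dom x0.
have := mirror_state_straight (tanlen_ge0 x y) (mirror_state_turn al0 j2 st).
move=> /mirror_state_reaches; rewrite -addrA -VS_arcS; congr reaches.
have sk (v : R) : sin (j * v) = j * sin v /\ cos (j * v) = cos v.
  have /orP[/eqP->|/eqP->] : (j == 1) || (j == -1) by rewrite -sqrf_eq1 j2.
    by rewrite !mul1r.
  by rewrite !mulN1r sinN cosN.
have [s1 c1] := sk (arcS x y).
rewrite sinD cosD s1 c1.
have ex := tangent_x r1 dom; have ey := tangent_y r1 dom.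
set al := arcS x y in ex ey *; set m := tanlen x y in ex ey *.
have {}ex : x = 1 - cos al + m * sin al by rewrite -[LHS](subrK 1) ex; ring.
have kk v : j * (j * v) = v by rewrite mulrA -expr2 j2 mul1r.
rewrite [in RHS]ex [in RHS]ey.
congr (rho * (k * _), rho * _).
- have -> : z1 + j * (sin th * cos al + cos th * (j * sin al) - sin th) +
    m * (cos th * cos al - sin th * (j * sin al)) =
    z1 + j * (sin th * cos al - sin th) + j * (j * (cos th * sin al)) +
    m * (cos th * cos al - sin th * (j * sin al)) by ring.
  by rewrite kk; ring.
- have -> : z2 - j * (cos th * cos al - sin th * (j * sin al) - cos th) +
    m * (sin th * cos al + cos th * (j * sin al)) =
    z2 - j * (cos th * cos al - cos th) + j * (j * (sin th * sin al)) +
    m * (sin th * cos al + cos th * (j * sin al)) by ring.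
  by rewrite kk; ring.
Qed.

Definition arcLL x y := atan (y / (x + 1)) + (atan (slr x y) - atan (slr x y / 3)).
Definition arcLR x y := pi + 2 * atan (slr x y).

Section Disk.
Variables x y : R.
Hypothesis r1 : (x - 1) ^+ 2 + y ^+ 2 < 1.

Lemma disk_x_gt0 : 0 < x.
Proof. by have := r1; have := sqr_ge0 y; nra. Qed.

Lemma disk_dl2_gt1 : 1 < dl2 x y.
Proof.
have x0 := disk_x_gt0.
have : 0 < x ^+ 2 by rewrite exprn_gt0.
by have := sqr_ge0 y; rewrite /dl2; lra.
Qed.

Lemma disk_dl2_lt9 : dl2 x y < 9.
Proof.
have x2 : x < 2 by have := r1; have := sqr_ge0 y; nra.
by have := r1; rewrite /dl2; lra.
Qed.

Lemma slr2 : slr x y ^+ 2 = (9 - dl2 x y) / (dl2 x y - 1).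
Proof.
rewrite sqr_sqrtr // divr_ge0 // subr_ge0 ltW //; first exact: disk_dl2_lt9.
exact: disk_dl2_gt1.
Qed.

Lemma arcLL_ge0 : 0 <= arcLL x y.
Proof.
have x0 := disk_x_gt0; have D1 := disk_dl2_gt1; have D9 := disk_dl2_lt9.
have s0 : 0 <= slr x y := sqrtr_ge0 _.
have x1 : 0 < x + 1 by lra.
rewrite /arcLL atanB_third //.
suff : - atan (y / (x + 1)) <= atan (2 * slr x y / (3 + slr x y ^+ 2)) by lra.
rewrite -atanN le_atan //.
have s2 := slr2; set s := slr x y in s0 s2 *; set D := dl2 x y in D1 D9 s2 *.
have s3 : 0 < 3 + s ^+ 2 by rewrite ltr_wpDr // sqr_ge0.
have rhs0 : 0 <= 2 * s / (3 + s ^+ 2) by rewrite divr_ge0 ?mulr_ge0 // ltW.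
have [y0|y0] := leP 0 y.
  by apply: le_trans rhs0; rewrite oppr_le0 divr_ge0 // ltW.
have lhs0 : 0 <= - (y / (x + 1)) by rewrite -mulNr divr_ge0 ?oppr_ge0 // ltW.
rewrite -(@ler_pXn2r _ 2) // ?nnegrE // sqrrN !expr_div_n exprMn s2.
have -> : 3 + (9 - D) / (D - 1) = 2 * (D + 3) / (D - 1).
  by field; rewrite gt_eqF // subr_gt0.
have -> : 2 ^+ 2 * ((9 - D) / (D - 1)) / (2 * (D + 3) / (D - 1)) ^+ 2 =
    (9 - D) * (D - 1) / (D + 3) ^+ 2.
  field; rewrite !gt_eqF ?subr_gt0 //; lra.
have D3 : 0 < D + 3 by lra.
have y2 : y ^+ 2 = D - (x + 1) ^+ 2 by rewrite /D /dl2; ring.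
rewrite ler_pdivrMr ?exprn_gt0 // mulrAC ler_pdivlMr ?exprn_gt0 // y2 -subr_ge0.
(* The factor 4 (x + 1) - (D + 3) is 1 - (x - 1)^2 - y^2: the left arc is nonnegative because the
   target is in the right disk. *)
have -> : (9 - D) * (D - 1) * (x + 1) ^+ 2 - (D - (x + 1) ^+ 2) * (D + 3) ^+ 2 =
  D * ((4 * (x + 1) - (D + 3)) * (4 * (x + 1) + (D + 3))) by ring.
have f1 : 0 <= 4 * (x + 1) - (D + 3) by have := r1; rewrite /D /dl2; lra.
by rewrite mulr_ge0 ?mulr_ge0 //; lra.
Qed.

Lemma VL_arcs : VL x y = arcLL x y + arcLR x y.
Proof. by rewrite /VL /arcLL /arcLR; ring. Qed.

Lemma arcLR_ge0 : 0 <= arcLR x y.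
Proof. by rewrite addr_ge0 ?pi_ge0 // mulr_ge0 // atan_ge0 // sqrtr_ge0. Qed.

(* With A = atan s and B = atan (s / 3), the end of the second arc relative to the
   centre of the left circle is 2 e^(i A) + e^(- i A) = (3 + i s) / sqrt (1 + s^2)
   up to a rotation: its argument is B and its modulus the distance of the target
   to that centre. *)
Lemma reaches_left_right T z1 z2 th : mirror_state k T z1 z2 th ->
  reaches rho (rho * (T + VL x y))
    (rho * (k * (z1 + x * sin th + y * cos th)), rho * (z2 - x * cos th + y * sin th)).
Proof.
move=> st.
have one : (1 : R) ^+ 2 = 1 by rewrite expr1n.
have mone : (- 1 : R) ^+ 2 = 1 by rewrite sqrrN expr1n.
have := mirror_state_turn arcLR_ge0 mone (mirror_state_turn arcLL_ge0 one st).
move=> /mirror_state_reaches; rewrite -addrA -VL_arcs; congr reaches.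
rewrite !mul1r !mulN1r.
have x0 := disk_x_gt0; have D1 := disk_dl2_gt1; have D9 := disk_dl2_lt9.
have s2 := slr2.
set s := slr x y in s2; set D := dl2 x y in D1 D9 s2.
pose A := atan s; pose B := atan (s / 3); pose chi := atan (y / (x + 1)).
have e1 : th + arcLL x y = th + chi - B + A by rewrite /arcLL /A /B /chi -/s; ring.
have e2 : th + arcLL x y - arcLR x y = th + chi - B - A - pi.
  by rewrite /arcLL /arcLR /A /B /chi -/s; ring.
have spi (v : R) : sin (v - pi) = - sin v by rewrite -[v in RHS](subrK pi) sinDpi opprK.
have cpi (v : R) : cos (v - pi) = - cos v by rewrite -[v in RHS](subrK pi) cosDpi opprK.
rewrite e2 e1 spi cpi.
pose psi := th + chi.
have x1 : 0 < x + 1 by lra.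
have x1n := lt0r_neq0 x1.
have D0 : 0 < D by rewrite (lt_trans ltr01).
have sD0 : 0 < Num.sqrt D by rewrite sqrtr_gt0.
have chiD : Num.sqrt (1 + (y / (x + 1)) ^+ 2) = Num.sqrt D / (x + 1).
  have -> : 1 + (y / (x + 1)) ^+ 2 = D * (x + 1)^-1 ^+ 2 by rewrite /D /dl2; field.
  by rewrite sqrtrM ?(ltW D0) // sqrtr_sqr ger0_norm // invr_ge0 ltW.
have cchi : Num.sqrt D * cos chi = x + 1.
  by rewrite cos_atan chiD; field; rewrite x1n gt_eqF.
have schi : Num.sqrt D * sin chi = y.
  by rewrite sin_atan chiD; field; rewrite x1n gt_eqF.
have u0 := sqrt1D_gt0 s; have v0 := sqrt1D_gt0 (s / 3).
have uv : 3 * Num.sqrt (1 + (s / 3) ^+ 2) / Num.sqrt (1 + s ^+ 2) = Num.sqrt D.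
  have q0 : 0 <= 3 * Num.sqrt (1 + (s / 3) ^+ 2) / Num.sqrt (1 + s ^+ 2).
    by rewrite divr_ge0 ?mulr_ge0 // sqrtr_ge0.
  rewrite -[LHS]ger0_norm // -sqrtr_sqr; congr Num.sqrt.
  have sq (v : R) : Num.sqrt (1 + v ^+ 2) ^+ 2 = 1 + v ^+ 2.
    by rewrite sqr_sqrtr // addr_ge0 // sqr_ge0.
  rewrite expr_div_n exprMn !sq.
  have -> : 1 + s ^+ 2 = 8 / (D - 1) by rewrite s2; field; rewrite gt_eqF // subr_gt0.
  rewrite expr_div_n s2; field.
  by rewrite gt_eqF // subr_gt0.
have key1 : 2 * sin (psi - B + A) + sin (psi - B - A) = Num.sqrt D * sin psi.
  rewrite -uv !(sinD _ A) !(sinB _ A) !(sinB _ B) !(cosB _ B) !cos_atan !sin_atan.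
  have v2 : Num.sqrt (1 + (s / 3) ^+ 2) ^+ 2 = 1 + (s / 3) ^+ 2.
    by rewrite sqr_sqrtr // addr_ge0 // sqr_ge0.
  move: u0 v0 v2; set u := Num.sqrt _; set v := Num.sqrt _ => u0 v0 v2.
  have -> : 3 * v / u * sin psi = 3 * v ^+ 2 / (u * v) * sin psi.
    by field; rewrite !gt_eqF.
  by rewrite v2; field; rewrite !gt_eqF.
have key2 : 2 * cos (psi - B + A) + cos (psi - B - A) = Num.sqrt D * cos psi.
  rewrite -uv !(cosD _ A) !(cosB _ A) !(sinB _ B) !(cosB _ B) !cos_atan !sin_atan.
  have v2 : Num.sqrt (1 + (s / 3) ^+ 2) ^+ 2 = 1 + (s / 3) ^+ 2.
    by rewrite sqr_sqrtr // addr_ge0 // sqr_ge0.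
  move: u0 v0 v2; set u := Num.sqrt _; set v := Num.sqrt _ => u0 v0 v2.
  have -> : 3 * v / u * cos psi = 3 * v ^+ 2 / (u * v) * cos psi.
    by field; rewrite !gt_eqF.
  by rewrite v2; field; rewrite !gt_eqF.
have p1 : Num.sqrt D * sin psi = (x + 1) * sin th + y * cos th.
  by rewrite -cchi -schi /psi sinD; ring.
have p2 : Num.sqrt D * cos psi = (x + 1) * cos th - y * sin th.
  by rewrite -cchi -schi /psi cosD; ring.
rewrite -/psi; congr (rho * (k * _), rho * _).
- have -> : z1 + (sin (psi - B + A) - sin th) - (- sin (psi - B - A) - sin (psi - B + A)) =
    z1 - sin th + (2 * sin (psi - B + A) + sin (psi - B - A)) by ring.
  by rewrite key1 p1; ring.
- have -> : z2 - (cos (psi - B + A) - cos th) - - (- cos (psi - B - A) - cos (psi - B + A)) =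
    z2 + cos th - (2 * cos (psi - B + A) + cos (psi - B - A)) by ring.
  by rewrite key2 p2; ring.
Qed.

End Disk.
End Mirror.
End Paths.

(** * Every longer length is realised *)

Section Elongation.
Context {R : realType}.
Variable rho : R.
Hypothesis rho_gt0 : 0 < rho.
Variable k : R.
Hypothesis k2 : k ^+ 2 = 1.
Implicit Types (x y a t : R).

(** Since f 0 <= t <= f t, the intermediate value theorem on [0, t] suffices. *)
Lemma stretch (f : R -> R) t : 0 <= t -> (forall a, 0 <= a -> {for a, continuous f}) ->
  f 0 <= t -> (forall a, 0 <= a -> a <= f a) -> exists2 a, 0 <= a & f a = t.
Proof.
move=> t0 cf f0 fa.
have cw : {within `[0, t], continuous f}.
  by apply: continuous_within => s /andP[s0 _]; exact: cf.
have ft := fa t t0.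
have [|a] := @IVT _ f 0 t t t0 cw.
  by rewrite ge_min f0 /= le_max ft orbT.
by rewrite in_itv /= => /andP[a0 _] e; exists a.
Qed.

Lemma VS_ge0 x y : 0 <= x -> (x, y) != (0, 0) -> 1 <= (x - 1) ^+ 2 + y ^+ 2 ->
  0 <= VS x y.
Proof.
move=> x0 n0 r1; have dom := rr_dom x0 r1 n0.
by rewrite VS_arcS addr_ge0 // ?tanlen_ge0 // arcS_ge0.
Qed.

Lemma VL_ge0 x y : (x - 1) ^+ 2 + y ^+ 2 < 1 -> 0 <= VL x y.
Proof. by move=> r1; rewrite VL_arcs addr_ge0 // ?arcLL_ge0 // arcLR_ge0. Qed.

(** The absolute value selects the turn towards the side of the target. The resulting length is
    continuous across x = 0, so the target may change side during a preliminary path. *)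
Lemma cvg_VS_norm {T : Type} {F : set_system T} {FF : Filter F} (f g : T -> R) (a b : R) :
  (a, b) != (0, 0) -> 1 <= (`|a| - 1) ^+ 2 + b ^+ 2 ->
  f x @[x --> F] --> a -> g x @[x --> F] --> b ->
  VS `|f x| (g x) @[x --> F] --> VS `|a| b.
Proof.
move=> n0 r1 fa gb; apply: cvg_VS => //; last exact: cvg_norm.
by apply: rr_dom => //; rewrite xpair_eqE normr_eq0.
Qed.

Lemma outside_neq0 x y : (y < 0) || (9 < (x + 1) ^+ 2 + y ^+ 2) -> (x, y) != (0, 0).
Proof.
apply: contraTneq => -[-> ->]; rewrite ltxx /= add0r expr1n expr0n /= addr0 -leNgt.
by rewrite (ler_nat _ 1 9).
Qed.

(** The disk of centre (-1, 0) and radius 3 contains both turning disks. *)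
Lemma far_outside x y : 9 < (x + 1) ^+ 2 + y ^+ 2 -> 1 <= (`|x| - 1) ^+ 2 + y ^+ 2.
Proof.
move=> d; have [x0|x0] := leP 0 x; last first.
  rewrite ltr0_norm //; lra.
rewrite ger0_norm //; have [x2|x2] := leP x 2; first by lra.
have : 0 < (x - 2) * x by rewrite mulr_gt0 //; lra.
by have := sqr_ge0 y; lra.
Qed.

Lemma reaches_tangent T z1 z2 th x y : mirror_state rho k T z1 z2 th ->
  (x, y) != (0, 0) -> 1 <= (`|x| - 1) ^+ 2 + y ^+ 2 ->
  reaches rho (rho * (T + VS `|x| y))
    (rho * (k * (z1 + x * sin th + y * cos th)), rho * (z2 - x * cos th + y * sin th)).
Proof.
move=> st n0 r1.
have n0' : (`|x|, y) != (0, 0) by move: n0; rewrite !xpair_eqE normr_eq0.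
have [x0|x0] := leP 0 x.
  have j2 : (-1 : R) ^+ 2 = 1 by rewrite sqrrN expr1n.
  have := reaches_turn_straight rho_gt0 k2 st j2 (normr_ge0 x) n0' r1.
  by rewrite ger0_norm //; congr (reaches _ _ (_ * (_ * _), _ * _)); ring.
have j2 : (1 : R) ^+ 2 = 1 by rewrite expr1n.
have := reaches_turn_straight rho_gt0 k2 st j2 (normr_ge0 x) n0' r1.
by rewrite ltr0_norm //; congr (reaches _ _ (_ * (_ * _), _ * _)); ring.
Qed.

Lemma continuous_rotation (x y : R) : continuous (fun a : R => x * cos a + y * sin a).
Proof.
move=> a; apply: cvgD; apply: cvgM; try exact: cvg_cst.
  exact: continuous_cos.
exact: continuous_sin.
Qed.

(* Outside the disk of centre (-1, 0) and radius 3, turning left first keeps the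
   target outside that disk, where VS is continuous. *)
Lemma reaches_far x y t : 9 < (x + 1) ^+ 2 + y ^+ 2 -> VS `|x| y <= t ->
  reaches rho (rho * t) (rho * (k * x), rho * y).
Proof.
move=> d Vt.
(* After a left turn of angle [a] the target, seen from the vehicle, has rotated clockwise by [a]
   about (-1, 0). *)
pose wx a := (x + 1) * cos a + y * sin a - 1.
pose wy a := y * cos a + - (x + 1) * sin a.
have dw a : 9 < (wx a + 1) ^+ 2 + wy a ^+ 2.
  have -> : (wx a + 1) ^+ 2 + wy a ^+ 2 =
      ((x + 1) ^+ 2 + y ^+ 2) * (cos a ^+ 2 + sin a ^+ 2) by rewrite /wx /wy; ring.
  by rewrite cos2Dsin2 mulr1.
have nw a : (wx a, wy a) != (0, 0) by apply: outside_neq0; rewrite dw orbT.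
have nx : (x, y) != (0, 0) by apply: outside_neq0; rewrite d orbT.
have n0 a : (`|wx a|, wy a) != (0, 0) by have := nw a; rewrite !xpair_eqE normr_eq0.
have t0 : 0 <= t.
  apply: le_trans Vt; apply: VS_ge0 => //; last exact: far_outside.
  by move: nx; rewrite !xpair_eqE normr_eq0.
pose f a := a + VS `|wx a| (wy a).
have [a a0|||a a0 fa] := @stretch f t t0.
- apply: cvgD; first exact: cvg_id.
  apply: cvg_VS_norm; [exact: nw|exact/far_outside/dw| |].
    by apply: cvgB; [exact: continuous_rotation|exact: cvg_cst].
  exact: continuous_rotation.
- by rewrite /f /wx /wy cos0 sin0 !mulr0 !mulr1 !addr0 addrK add0r.
- move=> a a0; rewrite lerDl; apply: VS_ge0 => //; exact/far_outside/dw.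
have j2 : (1 : R) ^+ 2 = 1 by rewrite expr1n.
have := mirror_state_turn rho_gt0 k2 a0 j2 (mirror_state_start rho k).
rewrite !add0r !mul1r => st.
have := reaches_tangent st (nw a) (far_outside (dw a)).
rewrite -/(f a) fa [pi / 2 + a]addrC sinDpihalf cosDpihalf sin_pihalf cos_pihalf.
have e := cos2Dsin2 a; rewrite /wx /wy.
congr (reaches _ _ (_ * (_ * _), _ * _)).
- have -> : cos a - 1 + ((x + 1) * cos a + y * sin a - 1) * cos a +
    (y * cos a + - (x + 1) * sin a) * - sin a =
    (x + 1) * (cos a ^+ 2 + sin a ^+ 2) - 1 by ring.
  by rewrite e; ring.
- have -> : - (- sin a - 0) - ((x + 1) * cos a + y * sin a - 1) * - sin a +
    (y * cos a + - (x + 1) * sin a) * cos a =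
    y * (cos a ^+ 2 + sin a ^+ 2) by ring.
  by rewrite e; ring.
Qed.

(* Driving straight first keeps the target behind and outside both disks. *)
Lemma reaches_back x y t : y < 0 -> 1 <= (`|x| - 1) ^+ 2 + y ^+ 2 ->
  VS `|x| y <= t -> reaches rho (rho * t) (rho * (k * x), rho * y).
Proof.
move=> y0 d Vt.
have ya a : 0 <= a -> y - a < 0 by lra.
have dw a : 0 <= a -> 1 <= (`|x| - 1) ^+ 2 + (y - a) ^+ 2.
  by move=> a0; apply: (le_trans d); rewrite lerD2l; nra.
have nw a : 0 <= a -> (x, y - a) != (0, 0).
  by move=> a0; apply: outside_neq0; rewrite ya.
have n0 a : 0 <= a -> (`|x|, y - a) != (0, 0).
  by move=> /nw; rewrite !xpair_eqE normr_eq0.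
have t0 : 0 <= t.
  apply: le_trans Vt; apply: VS_ge0 => //.
  by have := n0 0 (lexx 0); rewrite subr0.
pose f a := a + VS `|x| (y - a).
have [a a0|||a a0 fa] := @stretch f t t0.
- apply: cvgD; first exact: cvg_id.
  apply: cvg_VS_norm; [exact: nw|exact: dw|exact: cvg_cst|].
  by apply: cvgB; [exact: cvg_cst|exact: cvg_id].
- by rewrite /f subr0 add0r.
- move=> a a0; rewrite lerDl; apply: VS_ge0 => //; [exact: n0|exact: dw].
have := mirror_state_straight rho_gt0 k2 a0 (mirror_state_start rho k).
rewrite cos_pihalf sin_pihalf !add0r mulr0 mulr1 => st.
have := reaches_tangent st (nw a a0) (dw a a0).
rewrite -/(f a) fa sin_pihalf cos_pihalf.
congr (reaches _ _ (_ * (_ * _), _ * _)); ring.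
Qed.

(* Turning right first keeps the target in the right disk. *)
Lemma reaches_disk x y t : (x - 1) ^+ 2 + y ^+ 2 < 1 -> VL x y <= t ->
  reaches rho (rho * t) (rho * (k * x), rho * y).
Proof.
move=> d Vt.
(* After a right turn of angle [a] the target, seen from the vehicle, has rotated counterclockwise
   by [a] about (1, 0). *)
pose wx a := (x - 1) * cos a + - y * sin a + 1.
pose wy a := y * cos a + (x - 1) * sin a.
have dw a : (wx a - 1) ^+ 2 + wy a ^+ 2 < 1.
  have -> : (wx a - 1) ^+ 2 + wy a ^+ 2 =
      ((x - 1) ^+ 2 + y ^+ 2) * (cos a ^+ 2 + sin a ^+ 2) by rewrite /wx /wy; ring.
  by rewrite cos2Dsin2 mulr1.
have t0 : 0 <= t := le_trans (VL_ge0 d) Vt.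
pose f a := a + VL (wx a) (wy a).
have [a a0|||a a0 fa] := @stretch f t t0.
- apply: cvgD; first exact: cvg_id.
  apply: cvg_VL.
  + by have := disk_x_gt0 (dw a); lra.
  + exact: disk_dl2_gt1.
  + by apply: cvgD; [exact: continuous_rotation|exact: cvg_cst].
  + exact: continuous_rotation.
- by rewrite /f /wx /wy cos0 sin0 !mulr0 !mulr1 !addr0 subrK add0r.
- by move=> a a0; rewrite lerDl; exact: VL_ge0.
have j2 : (-1 : R) ^+ 2 = 1 by rewrite sqrrN expr1n.
have := mirror_state_turn rho_gt0 k2 a0 j2 (mirror_state_start rho k).
rewrite !add0r !mulN1r => st.
have := reaches_left_right rho_gt0 k2 (dw a) st.
rewrite -/(f a) fa [pi / 2 - a]addrC sinDpihalf cosDpihalf sin_pihalf cos_pihalf.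
rewrite sinN cosN.
have e := cos2Dsin2 a; rewrite /wx /wy.
congr (reaches _ _ (_ * (_ * _), _ * _)).
- have -> : - (cos a - 1) + ((x - 1) * cos a + - y * sin a + 1) * cos a +
    (y * cos a + (x - 1) * sin a) * - - sin a =
    (x - 1) * (cos a ^+ 2 + sin a ^+ 2) + 1 by ring.
  by rewrite e; ring.
- have -> : - - (- - sin a - 0) - ((x - 1) * cos a + - y * sin a + 1) * - - sin a +
    (y * cos a + (x - 1) * sin a) * cos a =
    y * (cos a ^+ 2 + sin a ^+ 2) by ring.
  by rewrite e; ring.
Qed.

End Elongation.

(** * Geometry of the regions *)

Section Regions.
Context {R : realType}.
Variable rho : R.
Hypothesis rho_gt0 : 0 < rho.
Implicit Types (x y k : R).

(** For x >= 0 the centre (1, 0) is the nearer one, so a lower bound on the distance to it and an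
    upper bound on the distance to (-1, 0) hold for both centres, whatever the sign [k]. *)
Lemma region3_scaled k x y : k ^+ 2 = 1 -> 0 <= x -> 0 < y ->
  1 < (x - 1) ^+ 2 + y ^+ 2 -> (x + 1) ^+ 2 + y ^+ 2 <= 9 ->
  region3 rho (rho * (k * x), rho * y).
Proof.
move=> k2 x0 y0 d1 d2.
have r2 : 0 < rho ^+ 2 by rewrite exprn_gt0.
have big (j : R) : j ^+ 2 = 1 ->
    (x + j) ^+ 2 + y ^+ 2 <= 9 /\ 1 < (x + j) ^+ 2 + y ^+ 2.
  move=> j2; have : (j == 1) || (j == -1) by rewrite -sqrf_eq1 j2.
  by case/orP => /eqP ->; split; lra.
have sc (j : R) : (rho * (k * x) + j * rho) ^+ 2 + (rho * y) ^+ 2 =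
    rho ^+ 2 * ((x + k * j) ^+ 2 + y ^+ 2).
  transitivity (rho ^+ 2 * (k ^+ 2 * x ^+ 2 + 2 * k * j * x + j ^+ 2 + y ^+ 2)).
    by ring.
  rewrite -[j ^+ 2 in LHS]mul1r -{2}k2; have -> : k ^+ 2 * x ^+ 2 = x ^+ 2 by rewrite k2 mul1r.
  ring.
have kj (j : R) : j ^+ 2 = 1 -> (k * j) ^+ 2 = 1 by rewrite exprMn k2 mul1r.
have one : (1 : R) ^+ 2 = 1 by rewrite expr1n.
have mone : (-1 : R) ^+ 2 = 1 by rewrite sqrrN expr1n.
have sr := sc (-1); have sl := sc 1.
rewrite mulN1r in sr; rewrite mul1r in sl.
have [br1 br2] := big _ (kj _ mone); have [bl1 bl2] := big _ (kj _ one).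
split; first split => /=.
- exact: mulr_gt0.
- by rewrite sr mulrC ler_pM2r.
- by rewrite sl mulrC ler_pM2r.
case; case; rewrite /disk_r /disk_l /=.
  by rewrite sr -[leRHS]mulr1 ler_pM2l // leNgt br2.
by rewrite sl -[leRHS]mulr1 ler_pM2l // leNgt bl2.
Qed.

Lemma region3_not_region12 p : region3 rho p ->
  ~ (region1 rho `|` region2 rho) p.
Proof.
move=> r3; case=> [r1|r2]; first by apply: r1; right.
by case: r3 => [[y0 _ _]]; apply.
Qed.

Lemma region3_limit (k : R) (f g : R -> R) x y :
  interior (region1 rho `|` region2 rho) (rho * (k * x), rho * y) ->
  f s @[s --> 0^'+] --> x -> g s @[s --> 0^'+] --> y ->
  (\forall s \near 0^'+, region3 rho (rho * (k * f s), rho * g s)) -> False.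
Proof.
move=> int fx gy r3.
have lim : (rho * (k * f s), rho * g s) @[s --> (0 : R)^'+] --> (rho * (k * x), rho * y).
  have l1 : rho * (k * f s) @[s --> (0 : R)^'+] --> rho * (k * x).
    by apply: cvgM; [exact: cvg_cst|apply: cvgM => //; exact: cvg_cst].
  have l2 : rho * g s @[s --> (0 : R)^'+] --> rho * y.
    by apply: cvgM => //; exact: cvg_cst.
  exact: (cvg_pair l1 l2).
have near_int := lim _ int.
near (0 : R)^'+ => s.
have r3s : region3 rho (rho * (k * f s), rho * g s) by near: s.
apply: (region3_not_region12 r3s); near: s; exact: near_int.
Unshelve. all: by end_near. Qed.

(** Any point of this closed quadrant outside the open right disk and within distance 3 of (-1, 0)
    is a limit of points of region 3, hence not interior to its complement. *)
Lemma interior_far k x y : k ^+ 2 = 1 ->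
  interior (region1 rho `|` region2 rho) (rho * (k * x), rho * y) ->
  0 <= x -> 0 <= y -> 1 <= (x - 1) ^+ 2 + y ^+ 2 -> 9 < (x + 1) ^+ 2 + y ^+ 2.
Proof.
move=> k2 int x0 y0 d1; rewrite ltNge; apply/negP => d2.
have sc : s @[s --> (0 : R)^'+] --> (0 : R) by apply: cvg_within; exact: cvg_id.
have [yp|yp] := ltP 0 y.
  move: d1; rewrite le_eqVlt => /predU1P[d1|d1]; last first.
    apply: (region3_limit (f := fun=> x) (g := fun=> y) int); try exact: cvg_cst.
    by near=> s; exact: region3_scaled.
  have x2 : x < 2.
    have : 0 < y ^+ 2 by rewrite exprn_gt0.
    nra.
  have xp : 0 < x.
    have : 0 < y ^+ 2 by rewrite exprn_gt0.
    nra.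
  (* A radial push away from (1, 0), multiplying the distance to it by 1 + s, leaves the disk. *)
  pose f s := x + (x - 1) * s; pose g s := y + y * s.
  have cf : f s @[s --> (0 : R)^'+] --> x.
    rewrite -[X in _ --> X]addr0 -[X in _ + X](mulr0 (x - 1)).
    by apply: cvgD; [exact: cvg_cst|apply: cvgM => //; exact: cvg_cst].
  have cg : g s @[s --> (0 : R)^'+] --> y.
    rewrite -[X in _ --> X]addr0 -[X in _ + X](mulr0 y).
    by apply: cvgD; [exact: cvg_cst|apply: cvgM => //; exact: cvg_cst].
  apply: (region3_limit int cf cg).
  have cd : (f s + 1) ^+ 2 + g s ^+ 2 @[s --> (0 : R)^'+] --> (x + 1) ^+ 2 + y ^+ 2.
    apply: cvgD; apply: cvg_sqr => //.
    by apply: cvgD => //; exact: cvg_cst.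
  have lt9 : (x + 1) ^+ 2 + y ^+ 2 < 9 by lra.
  have n9 := cvgr_lt _ cd _ lt9; have nx := cvgr_gt _ cf _ xp.
  near=> s.
  have s0 : 0 < s by near: s; exact: nbhs_right_gt.
  apply: region3_scaled => //.
  - by apply: ltW; near: s; exact: nx.
  - by rewrite /g addr_gt0 // mulr_gt0.
  - have -> : (f s - 1) ^+ 2 + g s ^+ 2 =
        (1 + s) ^+ 2 * ((x - 1) ^+ 2 + y ^+ 2) by rewrite /f /g; ring.
    by rewrite -d1 mulr1 exprn_egt1 // ltrDl.
  - by apply: ltW; near: s; exact: n9.
have yz : y = 0 by apply/eqP; rewrite eq_le yp y0.
move: d1 d2 int; rewrite yz expr0n /= !addr0 => d1 d2 int.
(* On the axis, being outside the open disk and within distance 3 of (-1, 0) leaves only the two end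
   points of a diameter of the right disk. *)
have /orP[/eqP x00|/eqP x2] : (x == 0) || (x == 2).
  have xle2 : x <= 2 by nra.
  have : 0 <= x * (x - 2) by lra.
  have : x * (x - 2) <= 0 by rewrite mulr_ge0_le0 // subr_le0.
  move=> h1 h2; have /eqP : x * (x - 2) = 0 by apply/eqP; rewrite eq_le h1 h2.
  by rewrite mulf_eq0 subr_eq0.
  rewrite x00 in int.
  apply: (region3_limit (f := fun=> 0) (g := id) int) => //; first exact: cvg_cst.
  near=> s.
  have s0 : 0 < s by near: s; exact: nbhs_right_gt.
  have s1 : s < 1 by near: s; exact: nbhs_right_lt.
  have ss : s * s < 1 * 1 by rewrite ltr_pM // ltW.
  by apply: region3_scaled => //; [have := mulr_gt0 s0 s0; lra|lra].
rewrite x2 in int.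
(* Near (2, 0) the circle about (1, 0) is x = 2 - y^2 / 2 to second order, and the circle of radius
   3 about (-1, 0) is x = 2 - y^2 / 6. With y = 3 s, the curve x = 2 - 2 s^2 runs between 2 - 9 s^2
   / 2 and 2 - 3 s^2 / 2. *)
pose f s : R := 2 - 2 * s ^+ 2; pose g s : R := 3 * s.
have cf : f s @[s --> (0 : R)^'+] --> (2 : R).
  rewrite -[X in _ --> X]subr0 -[X in _ - X](mulr0 2) -[X in _ * X](expr0n R 2).
  apply: cvgB; first exact: cvg_cst.
  by apply: cvgM; [exact: cvg_cst|exact: cvg_sqr].
have cg : g s @[s --> (0 : R)^'+] --> (0 : R).
  rewrite -[X in _ --> X](mulr0 3).
  by apply: cvgM => //; exact: cvg_cst.
apply: (region3_limit int cf cg).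
near=> s.
have s0 : 0 < s by near: s; exact: nbhs_right_gt.
have s1 : s < 1 / 2 by near: s; apply: nbhs_right_lt; rewrite divr_gt0.
have p2 : 0 < s ^+ 2 by rewrite exprn_gt0.
have q2 : s ^+ 2 < 1 / 4 by rewrite expr2; nra.
have q4 : s ^+ 2 * s ^+ 2 < 1 / 4 * s ^+ 2 by rewrite ltr_pM2r.
apply: region3_scaled => //; rewrite /f /g.
- by lra.
- by rewrite mulr_gt0.
- by have := mulr_gt0 p2 p2; lra.
- by lra.
Unshelve. all: by end_near. Qed.

End Regions.

(** * Continuity of the target and lower bounds in the original frame *)

Section Main.
Context {R : realType}.
Notation mu := (@lebesgue_measure R).
Implicit Types (x y k t : R).

Lemma target_coord_cvg (v : R -> R) (c tm : R) : 0 < tm ->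
  measurable_fun (`[0, +oo[ : set R) v -> (forall t, 0 <= t -> `|v t| <= 1) ->
  c + \int[mu]_(s in `[0, t]) v s @[t --> tm^'-] --> c + \int[mu]_(s in `[0, tm]) v s.
Proof.
move=> tm0 mv v1.
have vi : mu.-integrable `[0, tm] (EFin \o v).
  apply: (@bounded_itv_integrable _ _ _ _ 1).
    by apply: measurable_funS mv => //; apply: subset_itvl; rewrite bnd_simp.
  by move=> t /andP[t0 _]; exact: v1.
apply: cvgD; first exact: cvg_cst.
apply/cvgrPdist_le => e e0; near=> t.
have tt : t < tm by near: t; exact: nbhs_left_lt.
have t0 : 0 <= t by apply: ltW; near: t; exact: nbhs_left_gt.
have te : tm - e < t by near: t; apply: nbhs_left_gt; rewrite ltrBlDr ltrDl.
have := @Rintegral_increment R v 0 t tm (-1) 1 vi t0 (ltW tt).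
rewrite mulN1r mul1r -ler_norml => H; apply: (le_trans (H _)); last by lra.
by move=> s /andP[ts _]; rewrite -ler_norml v1 // (le_trans t0).
Unshelve. all: by end_near. Qed.

Lemma sqr1_abs x : exists2 k : R, k ^+ 2 = 1 & x = k * `|x|.
Proof.
have [x0|x0] := leP 0 x.
  by exists 1; [rewrite expr1n|rewrite mul1r ger0_norm].
by exists (-1); [rewrite sqrrN expr1n|rewrite ltr0_norm // mulN1r opprK].
Qed.

(** For k = -1 the motion is reflected, so that the bounds for the right disk also serve the left
    one. *)
Lemma min_lengths_le rho T (p : R * R) k x y : 0 < rho -> 0 <= T -> k ^+ 2 = 1 ->
  p = (rho * (k * x), rho * y) -> reaches rho T p ->
  [/\ ((x - 1) ^+ 2 + y ^+ 2 < 1 -> VL x y <= T / rho),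
      (y < 0 -> 1 <= (`|x| - 1) ^+ 2 + y ^+ 2 -> VS `|x| y <= T / rho) &
      (0 <= x -> 0 <= y -> (x, y) != (0, 0) -> 1 <= (x - 1) ^+ 2 + y ^+ 2 ->
        VS x y <= T / rho)].
Proof.
move=> r0 T0 k2 pE /(reaches_body_path r0 T0)[th [wx [wy [W]]]].
rewrite pE /= => wx0 wy0 wxT wyT.
have rn := lt0r_neq0 r0.
have [th' [wx' [W' wx0' wxT']]] : exists th' wx',
   [/\ body_path th' wx' wy (T / rho), wx' 0 = x & wx' (T / rho) = 0].
  have : (k == 1) || (k == -1) by rewrite -sqrf_eq1 k2.
  case/orP => /eqP kE.
    by exists th, wx; split => //; rewrite wx0 kE; field.
  exists (fun s => - th s), (fun s => - wx s); split.
  - exact: body_path_mirror.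
  - by rewrite wx0 kE; field.
  - by rewrite wxT oppr0.
have wy0' : wy 0 = y by rewrite wy0; field.
have T1 : 0 <= (0 : R) <= T / rho by rewrite lexx divr_ge0 // ltW.
rewrite -[T / rho]subr0 -wx0' -wy0'; split.
- exact: (VL_disk_le W').
- move=> y0 d; apply: (VS_back_le W') => //.
    by move: d; have [x0|x0] := leP 0 (wx' 0);
      [rewrite ger0_norm|rewrite ltr0_norm //]; lra.
  by move: d; have [x0|x0] := leP 0 (wx' 0);
    [rewrite ger0_norm|rewrite ltr0_norm //]; lra.
- by move=> x0 y0 n0 d; exact: (VS_front_le W').
Qed.

End Main.

(** * Interception slightly before the final time *)

Section NearTarget.
Context {R : realType}.
Variables (rho tm : R) (e1 e2 : R -> R) (k x y : R).
Hypothesis rho_gt0 : 0 < rho.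
Hypothesis k2 : k ^+ 2 = 1.
Hypothesis ce1 : e1 t @[t --> tm^'-] --> x.
Hypothesis ce2 : e2 t @[t --> tm^'-] --> y.

Let reached t := reaches rho t (rho * (k * e1 t), rho * e2 t).

Lemma near_lt_time (V : R -> R) (v : R) : V t @[t --> tm^'-] --> v ->
  v < tm / rho -> \forall t \near tm^'-, V t <= t / rho.
Proof.
move=> cV vt.
have c : t / rho - V t @[t --> tm^'-] --> tm / rho - v.
  apply: cvgB => //; apply: cvgM; last exact: cvg_cst.
  by apply: cvg_within; exact: cvg_id.
have p : 0 < tm / rho - v by rewrite subr_gt0.
have n := cvgr_gt _ c _ p.
near=> t; rewrite -subr_ge0; apply: ltW; near: t; exact: n.
Unshelve. all: by end_near. Qed.

Lemma near_VS : (x, y) != (0, 0) -> 1 <= (`|x| - 1) ^+ 2 + y ^+ 2 ->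
  VS `|x| y < tm / rho -> \forall t \near tm^'-, VS `|e1 t| (e2 t) <= t / rho.
Proof. by move=> n0 d; apply: near_lt_time; apply: cvg_VS_norm. Qed.

Lemma near_VL : 0 < x -> VL x y < tm / rho ->
  \forall t \near tm^'-, VL (e1 t) (e2 t) <= t / rho.
Proof.
move=> x0; apply: near_lt_time; apply: cvg_VL => //; first by lra.
have : 0 < x ^+ 2 by rewrite exprn_gt0.
by rewrite /dl2; have := sqr_ge0 y; lra.
Qed.

Lemma cvg_dist2 (c : R) :
  (e1 t - c) ^+ 2 + e2 t ^+ 2 @[t --> tm^'-] --> (x - c) ^+ 2 + y ^+ 2.
Proof.
by apply: cvgD; apply: cvg_sqr => //; apply: cvgB => //; exact: cvg_cst.
Qed.

Lemma unscale t : rho * (t / rho) = t.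
Proof. by rewrite mulrCA divff ?mulr1 // gt_eqF. Qed.

Lemma near_reached_disk : (x - 1) ^+ 2 + y ^+ 2 < 1 -> VL x y < tm / rho ->
  \forall t \near tm^'-, reached t.
Proof.
move=> d Vt; have nV := near_VL (disk_x_gt0 d) Vt.
have nd := cvgr_lt _ (@cvg_dist2 1) _ d.
near=> t; rewrite /reached -[X in reaches _ X]unscale.
apply: reaches_disk => //; near: t; [exact: nd|exact: nV].
Unshelve. all: by end_near. Qed.

Lemma near_reached_far : 9 < (x + 1) ^+ 2 + y ^+ 2 -> VS `|x| y < tm / rho ->
  \forall t \near tm^'-, reached t.
Proof.
move=> d Vt.
have n0 : (x, y) != (0, 0) by apply: outside_neq0; rewrite d orbT.
have nV := near_VS n0 (far_outside d) Vt.
have d' : 9 < (x - (-1)) ^+ 2 + y ^+ 2 by rewrite opprK.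
have nd := cvgr_gt _ (@cvg_dist2 (-1)) _ d'.
near=> t; rewrite /reached -[X in reaches _ X]unscale.
apply: reaches_far => //; last by near: t; exact: nV.
have : 9 < (e1 t - (-1)) ^+ 2 + e2 t ^+ 2 by near: t; exact: nd.
by rewrite opprK.
Unshelve. all: by end_near. Qed.

(** The limit point may lie on the circle itself, with the target on either side of it at earlier
    times. [VL] and [VS] have the same value there, so whichever path applies at time t is short
    enough. *)
Lemma near_reached_back : 0 <= x -> y < 0 -> 1 <= (x - 1) ^+ 2 + y ^+ 2 ->
  VS x y < tm / rho -> \forall t \near tm^'-, reached t.
Proof.
move=> x0 y0 d Vt.
have n0 : (x, y) != (0, 0) by apply: outside_neq0; rewrite y0.
have dn : 1 <= (`|x| - 1) ^+ 2 + y ^+ 2 by rewrite ger0_norm.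
have Vn : VS `|x| y < tm / rho by rewrite ger0_norm.
have nV := near_VS n0 dn Vn.
have ny := cvgr_lt _ ce2 _ y0.
have y2 : 0 < y ^+ 2 by rewrite exprn_even_gt0 //= lt_eqF.
(* The limit is strictly outside the left disk; this keeps the target off it at earlier times when
   [e1 t] is negative. *)
have l1 : 1 < (x - (-1)) ^+ 2 + y ^+ 2 by have := sqr_ge0 x; lra.
have nl := cvgr_gt _ (@cvg_dist2 (-1)) _ l1.
have nd : \forall t \near tm^'-, 1 <= (e1 t - 1) ^+ 2 + e2 t ^+ 2 \/
    ((e1 t - 1) ^+ 2 + e2 t ^+ 2 < 1 /\ VL (e1 t) (e2 t) <= t / rho).
  move: d; rewrite le_eqVlt => /predU1P[d|d].
    have xp : 0 < x.
      rewrite lt_neqAle x0 andbT; apply/eqP => xz; move: d y2.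
      by rewrite -xz; lra.
    have nVL : \forall t \near tm^'-, VL (e1 t) (e2 t) <= t / rho.
      by apply: near_VL => //; rewrite VL_boundary // ltW.
    near=> t; have [|h] := leP 1 ((e1 t - 1) ^+ 2 + e2 t ^+ 2); first by left.
    by right; split => //; near: t; exact: nVL.
  have n1 := cvgr_gt _ (@cvg_dist2 1) _ d.
  by near=> t; left; apply: ltW; near: t; exact: n1.
near=> t; rewrite /reached -[X in reaches _ X]unscale.
have [h1|[h1 h2]] : 1 <= (e1 t - 1) ^+ 2 + e2 t ^+ 2 \/
    ((e1 t - 1) ^+ 2 + e2 t ^+ 2 < 1 /\ VL (e1 t) (e2 t) <= t / rho) by near: t; exact: nd.
  have h2 : 1 < (e1 t - (-1)) ^+ 2 + e2 t ^+ 2 by near: t; exact: nl.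
  apply: reaches_back => //; [by near: t; exact: ny| |by near: t; exact: nV].
  have [p|p] := leP 0 (e1 t); first by rewrite ger0_norm.
  by rewrite ltr0_norm //; lra.
exact: reaches_disk.
Unshelve. all: by end_near. Qed.

End NearTarget.

Theorem theorem1 (R : realType) (rho : R) (hrho : 0 < rho)
    (x0 y0 : R) (vx vy : R -> R)
    (mvx : measurable_fun (`[0, +oo[ : set R) vx)
    (mvy : measurable_fun (`[0, +oo[ : set R) vy)
    (hv : forall t : R, 0 <= t -> Num.sqrt (vx t ^+ 2 + vy t ^+ 2) < 1)
    (tm : R)
    (htm : is_min_intercept_time rho (target_pos x0 y0 vx vy) tm)
    (hE : interior (region1 rho `|` region2 rho) (target_pos x0 y0 vx vy tm)) :
  tm = min_time rho (target_pos x0 y0 vx vy tm).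
Proof.
have [tm0 rtm tmin] := htm.
set E := target_pos x0 y0 vx vy in rtm tmin hE *.
have rn := lt0r_neq0 hrho.
(* [tm] is itself a time at which the point is reached, which bounds the infimum above; the work is
   to show that [tm] is a lower bound. *)
apply/le_anti/andP; split; last first.
  by apply: ge_inf; [exists 0 => T []|split => //; exact: ltW].
apply: lb_le_inf; first by exists tm; split => //; exact: ltW.
move=> T [T0 rT]; rewrite leNgt; apply/negP => Ttm.
have v1 t : 0 <= t -> `|vx t| <= 1 /\ `|vy t| <= 1.
  move=> t0; have h := hv t t0.
  have sq1 : vx t ^+ 2 + vy t ^+ 2 <= 1.
    rewrite -[X in X <= _]sqr_sqrtr ?addr_ge0 ?sqr_ge0 // expr_le1 ?sqrtr_ge0 //.
    exact: ltW.
  have := sqr_ge0 (vx t); have := sqr_ge0 (vy t) => p1 p2.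
  by split; rewrite -(@expr_le1 _ 2) // real_normK ?num_real //; lra.
have cE1 : (E t).1 @[t --> tm^'-] --> (E tm).1.
  by apply: target_coord_cvg => // t /v1[].
have cE2 : (E t).2 @[t --> tm^'-] --> (E tm).2.
  by apply: target_coord_cvg => // t /v1[].
suff : \forall t \near tm^'-, reaches rho t (E t).
  move=> nr; near tm^'- => t.
  have tt : t < tm by near: t; exact: nbhs_left_lt.
  have t0 : 0 < t by near: t; exact: nbhs_left_gt.
  by have := tmin t t0; rewrite leNgt tt => /(_ _)/negP; apply => //; near: t.
(* [k] is the sign of the abscissa at time [tm] and is kept for t < [tm], where [e1 t] may therefore
   be negative. *)
have [k k2 xE] := sqr1_abs ((E tm).1 / rho).
set x := `|_| in xE; have x_ge0 : 0 <= x by exact: normr_ge0.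
set y := (E tm).2 / rho.
pose e1 t := k * (E t).1 / rho; pose e2 t := (E t).2 / rho.
have kk z : k * (k * z) = z by rewrite mulrA -expr2 k2 mul1r.
have EE : forall t, E t = (rho * (k * e1 t), rho * e2 t).
  by move=> t; rewrite /e1 /e2 -mulrA kk !unscale // -surjective_pairing.
have e1x : e1 tm = x by rewrite /e1 -mulrA xE kk.
have pE : E tm = (rho * (k * x), rho * y) by rewrite EE e1x.
have ce1 : e1 t @[t --> tm^'-] --> x.
  rewrite -e1x; apply: cvgM; last exact: cvg_cst.
  by apply: cvgM => //; exact: cvg_cst.
have ce2 : e2 t @[t --> tm^'-] --> y by apply: cvgM => //; exact: cvg_cst.
have [VLT VBT VFT] := min_lengths_le hrho T0 k2 pE rT.
have TT : T / rho < tm / rho by rewrite ltr_pM2r // invr_gt0.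
suff : \forall t \near tm^'-, reaches rho t (rho * (k * e1 t), rho * e2 t).
  by apply: filterS => t; rewrite -EE.
have [d|d] := ltP ((x - 1) ^+ 2 + y ^+ 2) 1.
  exact: near_reached_disk (le_lt_trans (VLT d) TT).
have [yn|yp] := ltP y 0.
  apply: (near_reached_back hrho k2 ce1 ce2) => //.
  rewrite -[x]ger0_norm //; apply: le_lt_trans TT; apply: VBT => //.
  by rewrite ger0_norm.
have far : 9 < (x + 1) ^+ 2 + y ^+ 2.
  by apply: (interior_far hrho k2) => //; rewrite -pE.
apply: (near_reached_far hrho k2 ce1 ce2 far).
rewrite ger0_norm //; apply: le_lt_trans TT; apply: VFT => //.
by apply: outside_neq0; rewrite far orbT.
Unshelve. all: by end_near. Qed.
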